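(* Let $(G,F)$ be a framed graph, let $\Delta_{G,F}$ be the framed triangulation of the flow polytope $\mathcal{F}_G$, and let $\mathscr{L}_{G,F}$ be the corresponding framing lattice. Then the following three posets are isomorphic: (1) the set of interior faces of $\Delta_{G,F}$, ordered by reverse inclusion; (2) the set of all sets $S$ of pairwise coherent routes of $(G,F)$ that cover $G$, ordered by reverse inclusion; (3) the set of pure intervals of $\mathscr{L}_{G,F}$, ordered by inclusion.
   Context: Flow graphs and flow polytopes. A flow graph $G$ is a finite directed acyclic graph (multiple edges allowed) with vertex set $[n]=\{1,\dots,n\}$ and edge multiset $E(G)$, all edges directed from smaller to larger vertices, with unique source $1$ and unique sink $n$. For a vertex $v$, $\mathrm{In}(v)$ and $\mathrm{Out}(v)$ are its sets of incoming and outgoing edges. A route is a directed path from $1$ to $n$. The flow polytope $\mathcal{F}_G\subset\mathbb{R}^{E(G)}$ is the set of nonnegative $(x_e)_{e}$ with $\sum_{e\in \mathrm{Out}(j)}x_e-\sum_{e\in \mathrm{In}(j)}x_e=u_j$ for all $j$, where $u_1=1$, $u_n=-1$, $u_j=0$ otherwise. Its vertices are the $0/1$ indicator vectors of the routes. Framings and coherence. A framing $F$ of $G$ is a choice, at every vertex $v$, of linear orders on $\mathrm{In}(v)$ and on $\mathrm{Out}(v)$; $(G,F)$ is called a framed graph. For a path $P$ through $v$ let $Pv$ (resp. $vP$) be its maximal subpath ending (resp. beginning) at $v$. For paths $P,Q$ through $v$: let $w\le v$ be the smallest vertex after which $Pv$ and $Qv$ coincide; if $w$ is the first vertex of $Pv$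 or $Qv$, then $Pv=_{\mathscr{I}(v)}Qv$; otherwise $Pv<_{\mathscr{I}(v)}Qv$ iff the edge of $P$ entering $w$ is smaller, in the order on $\mathrm{In}(w)$, than the edge of $Q$ entering $w$. Similarly, let $w'\ge v$ be the largest vertex before which $vP$ and $vQ$ coincide; if $w'$ is the last vertex of $vP$ or $vQ$, then $vP=_{\mathscr{O}(v)}vQ$; otherwise $vP<_{\mathscr{O}(v)}vQ$ iff the edge of $P$ leaving $w'$ is smaller, in the order on $\mathrm{Out}(w')$, than the edge of $Q$ leaving $w'$. Two routes $P,Q$ are incoherent at a common inner vertex $v$ ($v\ne 1,n$) if $Pv<_{\mathscr{I}(v)}Qv$ and $vQ<_{\mathscr{O}(v)}vP$, or $Qv<_{\mathscr{I}(v)}Pv$ and $vP<_{\mathscr{O}(v)}vQ$; they are coherent if they are incoherent at no common inner vertex. A clique is a set of pairwise coherent routes; a maximal clique is an inclusion-maximal one. A set $S$ of routes covers $G$ if every edge of $G$ lies in some route of $S$. Framed triangulation. For a clique $S$ let $\Delta_S$ be the convex hull of the indicator vectors of its routes. By Danilov–Karzanov–Koshevoy, the $\Delta_C$, $C$ a maximal clique, are the top-dimensional simplices of a regular unimodular triangulation $\Delta_{G,F}$ of $\mathcal{F}_G$ (the framed triangulation); its faces are the $\Delta_S$, $S$ a clique, and $\Delta_S$ is identified with $S$. A face is a boundary face if it is contained in the (relative) boundary of $\mathcal{F}_G$, and an interior face otherwise. Framing lattice. Let $C\neq C'$ be maximal cliques with $C'=(C\setminus\{R\})\cup\{R'\}$.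 Then $R,R'$ are incoherent at some vertex $v$. Write $R<^{\mathrm{cw}}_v R'$ if $Rv\leq_{\mathscr{I}(v)}R'v$ and $vR'\leq_{\mathscr{O}(v)}vR$ at such a vertex; in this case put $C\prec C'$ ($C'$ is obtained from $C$ by a counterclockwise rotation, $R$ is rotated upwards in $C$, and $R'$ is the increasing flip of $R$). $\mathscr{L}_{G,F}$ is the set of maximal cliques ordered by the reflexive-transitive closure of $\prec$; it is a lattice whose cover relation is $\prec$ (von Bell–Ceballos). Pure intervals. $\mathrm{Asc}(C)$ is the set of routes of $C$ that can be rotated upwards in $C$. For $a\in\mathrm{Asc}(C)$ with increasing flip $a'$, $C+a:=(C\setminus\{a\})\cup\{a'\}$. For $A\subseteq \mathrm{Asc}(C)$, $C+A:=\bigvee_{a\in A}(C+a)$, with $C+\emptyset:=C$. The intervals $[C,C+A]$, for $C$ a maximal clique and $A\subseteq\mathrm{Asc}(C)$, are the pure intervals. Any of the three posets in the claim is called the framingtope $\mathscr{P}_{G,F}$. *)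

(* Defs.v *)
From HB Require Import structures.
From mathcomp Require Import all_boot all_order all_algebra.
From mathcomp Require Import boolp classical_sets functions reals topology.
From mathcomp Require Import normedtype.

Set Implicit Arguments.
Unset Strict Implicit.
Unset Printing Implicit Defensive.

Import Order.TTheory GRing.Theory Num.Theory.
Import numFieldNormedType.Exports.

Local Open Scope ring_scope.

(* The vertices 1, ..., n are 'I_n with n = fg_n.+2, so that n >= 2 (the source
   and the sink differ); the edge multiset is a finite type with endpoint maps.
   Since edges increase, ord0 is a source and ord_max is a sink; the last two
   fields say that there are no others. *)
Record flow_graph := FlowGraph {
  fg_n : nat;
  edge : finType;
  src : edge -> 'I_fg_n.+2;
  tgt : edge -> 'I_fg_n.+2;
  src_lt_tgt : forall e, (src e < tgt e)%N;
  source_unique : forall v, v != ord0 -> exists e, tgt e = v;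
  sink_unique : forall v, v != ord_max -> exists e, src e = v
}.

Notation vertex G := 'I_(fg_n G).+2.

Definition In (G : flow_graph) (v : vertex G) : {set edge G} :=
  [set e | tgt e == v].
Definition Out (G : flow_graph) (v : vertex G) : {set edge G} :=
  [set e | src e == v].

Definition linear_order_on (T : finType) (A : {set T}) (r : rel T) : Prop :=
  [/\ {in A, forall x, r x x}, {in A &, antisymmetric r},
      {in A & &, transitive r} & {in A &, total r}].

Record framing (G : flow_graph) := Framing {
  in_le : vertex G -> rel (edge G);
  out_le : vertex G -> rel (edge G);
  in_le_linear : forall v, linear_order_on (In v) (in_le v);
  out_le_linear : forall v, linear_order_on (Out v) (out_le v)
}.

Definition is_route (G : flow_graph) (p : seq (edge G)) : bool :=
  if p is e :: p' then
    [&& src e == ord0, path (fun e f => tgt e == src f) e p'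
      & tgt (last e p') == ord_max]
  else false.

(* Edges increase, so a directed path has fewer edges than there are vertices:
   the length bound excludes no route and only serves to make [route] finite. *)
Record route (G : flow_graph) := Route {
  route_edges :> {bseq (fg_n G).+2 of edge G};
  route_edgesP : is_route route_edges
}.
HB.instance Definition _ (G : flow_graph) := [isSub for @route_edges G].
HB.instance Definition _ (G : flow_graph) := [Finite of route G by <:].

Section Coherence.
Variables (G : flow_graph) (F : framing G).
Implicit Types (P Q : route G) (v w : vertex G).

Definition vertices P : seq (vertex G) := ord0 :: [seq tgt e | e <- P].

(* The subpath of P from v to w: vertices increase along a route. *)
Definition segment P v w : seq (edge G) :=
  [seq e <- P | (v <= src e)%N && (tgt e <= w)%N].

Definition agree P Q v w : bool :=
  [&& (v <= w)%N, v \in vertices P, v \in vertices Q,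
      w \in vertices P, w \in vertices Q & segment P v w == segment Q v w].

(* w is the smallest vertex after which Pv and Qv coincide *)
Definition split_in v P Q w : bool :=
  agree P Q w v && [forall w', agree P Q w' v ==> (w <= w')%N].

(* w is the largest vertex before which vP and vQ coincide *)
Definition split_out v P Q w : bool :=
  agree P Q v w && [forall w', agree P Q v w' ==> (w' <= w)%N].

(* The first (last) vertex of a route is ord0 (ord_max). *)
Definition eqI v P Q : bool := split_in v P Q ord0.

Definition ltI v P Q : bool :=
  [exists w, split_in v P Q w &&
    [exists e in In w, exists f in In w,
       [&& e \in (P : seq _), f \in (Q : seq _), e != f & in_le F w e f]]].

Definition leI v P Q : bool := ltI v P Q || eqI v P Q.

Definition eqO v P Q : bool := split_out v P Q ord_max.

Definition ltO v P Q : bool :=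
  [exists w, split_out v P Q w &&
    [exists e in Out w, exists f in Out w,
       [&& e \in (P : seq _), f \in (Q : seq _), e != f & out_le F w e f]]].

Definition leO v P Q : bool := ltO v P Q || eqO v P Q.

Definition incoherent_at v P Q : bool :=
  [&& v != ord0, v != ord_max, v \in vertices P, v \in vertices Q
    & (ltI v P Q && ltO v Q P) || (ltI v Q P && ltO v P Q)].

Definition coherent P Q : bool := [forall v, ~~ incoherent_at v P Q].

Definition clique (S : {set route G}) : bool :=
  [forall P in S, forall Q in S, coherent P Q].

Definition covers (S : {set route G}) : bool :=
  [forall e, exists P in S, e \in (P : seq _)].

Definition coherent_covers : set {set route G} :=
  (fun S => clique S /\ covers S).

End Coherence.

Definition max_clique (G : flow_graph) (F : framing G) : finType :=
  {C : {set route G} | maxset (clique F) C}.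

Section FramingLattice.
Variables (G : flow_graph) (F : framing G).
Implicit Types (R : route G) (A : {set route G}).
Implicit Types (C D : max_clique F) (I X : {set max_clique F}).

Definition cw_lt R R' : bool :=
  [exists v, [&& incoherent_at F v R R', leI F v R R' & leO F v R' R]].

(* C' is obtained from C by rotating R upwards *)
Definition rotation C R C' : bool :=
  [&& C != C', R \in val C
    & [exists R', (val C' == R' |: (val C :\ R)) && cw_lt R R']].

Definition rot C C' : bool := [exists R, rotation C R C'].

Definition framing_le : rel (max_clique F) := connect rot.

Definition framing_interval C D : {set max_clique F} :=
  [set C' | framing_le C C' && framing_le C' D].

Definition is_join X D : bool :=
  [forall C in X, framing_le C D] &&
  [forall D', [forall C in X, framing_le C D'] ==> framing_le D D'].

Definition Asc C : {set route G} :=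
  [set a in val C | [exists C', rotation C a C']].

(* D = C + A; the join is relational, so that no lattice structure has to be
   built beforehand. *)
Definition is_plus C A D : bool :=
  if A == finset.set0 then D == C
  else is_join [set C' | [exists a in A, rotation C a C']] D.

Definition pure_intervals : set {set max_clique F} :=
  (fun I => exists C A D,
     [/\ A \subset Asc C, is_plus C A D & I = framing_interval C D]).

End FramingLattice.

Arguments pure_intervals {G} F _.

(* R^E is {ptws E -> R}, functions with the product topology. *)
Section Convexity.
Variables (R : realType) (E : finType).
Implicit Types (K : set {ptws E -> R}) (x : {ptws E -> R}).
Local Open Scope classical_set_scope.

Definition convex_hull K : set {ptws E -> R} :=
  [set x | exists m (t : 'I_m -> R) (p : 'I_m -> {ptws E -> R}),
     [/\ forall i, 0 <= t i, forall i, K (p i), \sum_i t i = 1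
       & forall e, x e = \sum_i t i * p i e]].

Definition affine_hull K : set {ptws E -> R} :=
  [set x | exists m (t : 'I_m -> R) (p : 'I_m -> {ptws E -> R}),
     [/\ forall i, K (p i), \sum_i t i = 1
       & forall e, x e = \sum_i t i * p i e]].

Definition relative_interior K : set {ptws E -> R} :=
  [set x | K x /\ \forall y \near x, affine_hull K y -> K y].

Definition relative_boundary K : set {ptws E -> R} :=
  closure K `\` relative_interior K.

End Convexity.

Section Polytope.
Variables (R : realType) (G : flow_graph) (F : framing G).
Local Open Scope classical_set_scope.

Definition netflow (j : vertex G) : R :=
  if j == ord0 then 1 else if j == ord_max then -1 else 0.

Definition flow_polytope : set {ptws edge G -> R} :=
  [set x | (forall e, 0 <= x e) /\
     forall j, \sum_(e in Out j) x e - \sum_(e in In j) x e = netflow j].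

Definition indicator (P : route G) : {ptws edge G -> R} :=
  fun e => (e \in (P : seq _))%:R.

Definition Delta (S : {set route G}) : set {ptws edge G -> R} :=
  convex_hull [set indicator P | P in [set` S]].

Definition interior_faces : set (set {ptws edge G -> R}) :=
  [set D | (exists2 S : {set route G}, clique F S & D = Delta S) /\
     ~ (D `<=` relative_boundary flow_polytope)].

End Polytope.

Arguments interior_faces R {G} F _.

(* Isomorphism of the posets (A, leA) and (B, leB). *)
Definition poset_isomorphic (T U : Type) (A : set T) (leA : T -> T -> Prop)
    (B : set U) (leB : U -> U -> Prop) : Prop :=
  exists2 f : T -> U, set_bij A B f &
    forall x y, A x -> A y -> (leA x y <-> leB (f x) (f y)).

(* Main.v *)
Require Import Defs.
From mathcomp Require Import all_boot all_order all_algebra.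
From mathcomp Require Import boolp classical_sets functions reals topology.
From mathcomp Require Import normedtype.
From mathcomp Require Import seq fintype finset zify.

(** Why the three posets agree.

    From (1) to (2).  A convex combination of 0/1 vectors that is again a 0/1
    vector has all its weight on that vector, and a route is determined by its
    edge set.  Hence [Delta S] contains the indicator of P exactly when P is in
    S, so that [Delta] preserves and reflects inclusion.  If S covers the graph,
    the barycentre of [Delta S] has positive coordinates and is a relative
    interior point of the flow polytope; if S misses an edge e, then [Delta S]
    lies in the hyperplane x_e = 0, which some route leaves, and every point of
    [Delta S] is a boundary point.

    From (2) to (3).  A clique S is sent to its star, the set of the maximal
    cliques that contain S.  At a vertex v a route is a pair (prefix, suffix),
    prefixes and suffixes are linearly ordered, and coherence at v says that two
    pairs are comparable in the product order.  So a clique S draws at every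
    vertex a staircase, the chain of the pairs of its routes through v.  Four
    observations carry the proof.

    - Gluing ([ncw_glue]).  If a prefix of T is glued at v to a suffix of B, and
      T and B are coherent with Y, then the new route can be incoherent with Y
      only at v.

    - Saturation ([maximal_family_saturated]).  By gluing, two consecutive
      points of the staircase of a maximal clique share their prefix or their
      suffix.  The flips of a maximal clique are the exchanges of an upper left
      corner of a staircase with the opposite, lower right one ([flipP],
      [rotation_corner]), and maximal cliques cover the graph
      ([maximal_family_covering]).

    - A global form of the order ([framing_leP]).  C is below D in the framing
      lattice iff no route of D is, at any vertex, strictly to the upper left of
      a route of C.  This relation is transitive by saturation
      ([below_trans]); every flip goes up for it; and if C lies below a
      different D, some corner of C can be flipped without leaving the lower set
      of D ([below_step]).

    - Comparison of a maximal clique D containing S with a route R coherent with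
      S ([corner_outside]).  If a route of D is to the upper left of R, then some
      corner of D does not belong to S.  It is found where R, or a modification
      of R, leaves the tree of the prefixes that occur in D.

    By the last point the star of S has a greatest and a least element, and it is
    the interval between them.  If S covers the graph, the routes outside S of
    the least element C are all corners ([corner_of_covering]), and the greatest
    element is the join of their flips ([flips_below]), so the star is a pure
    interval.  Conversely, if A consists of corners of C, then C minus A covers
    the graph ([covering_setD]) and C is the least element of its star, because
    a route is never both an upper left and a lower right corner
    ([corner_not_both]).  Finally, a covering clique is the intersection of its
    star, because every further route of a member can be flipped away
    ([star_sub]).

    The combinatorial part is written for an abstract [route_system], in which
    prefixes and suffixes play symmetric roles.  Exchanging them reverses the
    order of the vertices and the relation [cw], so one duality yields both the
    passage from prefixes to suffixes and the passage from the greatest element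
    of a star to the least one. *)

Set Implicit Arguments.
Unset Strict Implicit.
Unset Printing Implicit Defensive.

(** Linear arithmetic from the hypotheses that compare ranks or positions. *)
Ltac ord :=
  intros; try done;
  repeat match goal with
  | H : _ /\ _ |- _ => destruct H
  | H : _ \/ _ |- _ => destruct H
  | H : and3 _ _ _ |- _ => destruct H
  | H : and4 _ _ _ _ |- _ => destruct H
  end;
  repeat match goal with
  | H : ~ (@eq ?T _ _) |- _ =>
      lazymatch T with nat => fail | _ => change T with nat in H end
  | H : @eq ?T _ _ |- _ =>
      lazymatch T with nat => fail | _ => change T with nat in H end
  end;
  repeat match goal with
  | H : ?T |- _ =>
      lazymatch type of T with Prop => idtac end;
      lazymatch T with
      | is_true (leq _ _) => fail
      | is_true (negb (leq _ _)) => fail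
      | @eq nat _ _ => fail
      | ~ (@eq nat _ _) => fail
      | is_true (leq _ _) -> is_true (leq _ _) => fail
      | _ => clear H
      end
  end; lia.

Lemma ex_argmin (T : finType) (A : pred T) (f : T -> nat) :
  (exists x, A x) -> exists2 x, A x & forall y, A y -> f x <= f y.
Proof. by case=> x Ax; case: (arg_minnP f Ax) => y Ay ymin; exists y. Qed.

Lemma ex_argmax (T : finType) (A : pred T) (f : T -> nat) :
  (exists x, A x) -> exists2 x, A x & forall y, A y -> f y <= f x.
Proof. by case=> x Ax; case: (arg_maxnP f Ax) => y Ay ymax; exists y. Qed.

(** * Route systems *)

(** What the argument needs to know about the routes of a framed graph.  The
    prefix of P ending at v is represented by a natural number [pre v P], its
    rank in the linear order of all prefixes ending at v, and likewise for the
    suffixes and [suf]; comparisons of half-routes become linear arithmetic.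
    [agrees u v P Q] says that P and Q have the same edges between u and v, and
    [glue v P Q] follows P up to v and Q afterwards.  The fields [pre_diverge]
    and [suf_diverge] express that the comparison is lexicographic: if P and
    Q differ between u and v, their comparison is unchanged when P is modified
    outside that interval. *)
Record route_system := RouteSystem {
  sroute : finType;
  svertex : finType;
  pos : svertex -> nat;
  copos : svertex -> nat;
  depth : nat;
  pos_copos : forall v, pos v + copos v = depth;
  pos_inj : injective pos;
  source : svertex;
  sink : svertex;
  pos_source : forall v, pos source <= pos v;
  pos_sink : forall v, pos v <= pos sink;
  source_lt_sink : pos source < pos sink;
  visits : sroute -> svertex -> bool;
  visits_source : forall P, visits P source;
  visits_sink : forall P, visits P sink;
  pre : svertex -> sroute -> nat;
  suf : svertex -> sroute -> nat;
  pre_source : forall P Q, pre source P = pre source Q;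
  suf_sink : forall P Q, suf sink P = suf sink Q;
  route_ext : forall v P Q,
    visits P v -> visits Q v -> pre v P = pre v Q -> suf v P = suf v Q -> P = Q;
  agrees : svertex -> svertex -> sroute -> sroute -> bool;
  agrees_visits : forall u v P Q, agrees u v P Q ->
    [/\ pos u <= pos v, visits P u, visits P v, visits Q u & visits Q v];
  agrees_refl : forall u v P, pos u <= pos v -> visits P u -> visits P v -> agrees u v P P;
  agrees_sym : forall u v P Q, agrees u v P Q -> agrees u v Q P;
  agrees_trans : forall u v P Q R, agrees u v P Q -> agrees u v Q R -> agrees u v P R;
  agrees_sub : forall u w v P Q, agrees u v P Q -> visits P w ->
    pos u <= pos w -> pos w <= pos v -> agrees u w P Q /\ agrees w v P Q;
  agrees_cat : forall u w v P Q, agrees u w P Q -> agrees w v P Q -> agrees u v P Q;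
  agrees_pre : forall u v P Q, agrees u v P Q -> (pre u P < pre u Q) = (pre v P < pre v Q);
  agrees_suf : forall u v P Q, agrees u v P Q -> (suf u P < suf u Q) = (suf v P < suf v Q);
  pre_agrees : forall u v P Q, pre v P = pre v Q -> visits P v -> visits Q v ->
    pos u <= pos v -> visits P u -> agrees u v P Q;
  suf_agrees : forall u v P Q, suf u P = suf u Q -> visits P u -> visits Q u ->
    pos u <= pos v -> visits P v -> agrees u v P Q;
  pre_diverge : forall u v P P' Q, agrees u v P P' -> visits Q v ->
    (pre v P < pre v Q -> agrees u v P Q \/ pre v P' < pre v Q) /\
    (pre v Q < pre v P -> agrees u v P Q \/ pre v Q < pre v P');
  suf_diverge : forall u v P P' Q, agrees u v P P' -> visits Q u ->
    (suf u P < suf u Q -> agrees u v P Q \/ suf u P' < suf u Q) /\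
    (suf u Q < suf u P -> agrees u v P Q \/ suf u Q < suf u P');
  glue : svertex -> sroute -> sroute -> sroute;
  glueP : forall v P Q, visits P v -> visits Q v ->
    [/\ visits (glue v P Q) v, pre v (glue v P Q) = pre v P
      & suf v (glue v P Q) = suf v Q]
}.

Arguments route_ext {r} v {P Q}.

Section Swap.
Variable G : route_system.

Lemma copos_le (u v : svertex G) : (copos u <= copos v) = (pos v <= pos u).
Proof. have := pos_copos u; have := pos_copos v; lia. Qed.

#[local] Obligation Tactic := idtac.
(** Reversing all edges.  The reversed graph has the same routes, with prefixes
    and suffixes exchanged. *)
Program Definition swap : route_system := {|
  sroute := sroute G; svertex := svertex G; pos := @copos G; copos := @pos G; depth := depth G;
  source := sink G; sink := source G; visits := @visits G; pre := @suf G; suf := @pre G;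
  agrees := fun u v P Q => agrees v u P Q;
  glue := fun v P Q => glue v Q P |}.
Next Obligation. by move=> v; rewrite addnC pos_copos. Qed.
Next Obligation.
by move=> u v e; apply: (@pos_inj G); have := pos_copos u; have := pos_copos v; lia.
Qed.
Next Obligation. by move=> v; rewrite copos_le pos_sink. Qed.
Next Obligation. by move=> v; rewrite copos_le pos_source. Qed.
Next Obligation. by rewrite ltnNge copos_le -ltnNge source_lt_sink. Qed.
Next Obligation. exact: visits_sink. Qed.
Next Obligation. exact: visits_source. Qed.
Next Obligation. exact: suf_sink. Qed.
Next Obligation. exact: pre_source. Qed.
Next Obligation. by move=> v P Q tP tQ eb ea; apply: (route_ext v). Qed.
Next Obligation. by move=> u v P Q /= /agrees_visits[] *; rewrite copos_le. Qed.
Next Obligation. by move=> u v P /=; rewrite copos_le => *; apply: agrees_refl. Qed.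
Next Obligation. by move=> u v P Q /=; apply: agrees_sym. Qed.
Next Obligation. by move=> u v P Q R /=; apply: agrees_trans. Qed.
Next Obligation.
move=> u w v P Q /= h tw; rewrite !copos_le => h1 h2.
by have [] := agrees_sub h tw h2 h1.
Qed.
Next Obligation. by move=> u w v P Q /= h1 h2; apply: agrees_cat h2 h1. Qed.
Next Obligation. by move=> u v P Q /= /agrees_suf. Qed.
Next Obligation. by move=> u v P Q /= /agrees_pre. Qed.
Next Obligation. by move=> u v P Q /= h1 h2 h3; rewrite copos_le; apply: suf_agrees. Qed.
Next Obligation. by move=> u v P Q /= h1 h2 h3; rewrite copos_le; apply: pre_agrees. Qed.
Next Obligation. by move=> u v P P' Q; apply: suf_diverge. Qed.
Next Obligation. by move=> u v P P' Q; apply: pre_diverge. Qed.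
Next Obligation. by move=> v P Q /= tP tQ; have [] := glueP tQ tP. Qed.

End Swap.

(** * Coherence and gluing *)

Section Coherence.
Variable G : route_system.
Implicit Types (P Q R T B X Y Z : sroute G) (u v w x y : svertex G) (S C D : {set sroute G}).

(** P is strictly to the upper left of Q at v, prefixes being drawn from left to
    right and suffixes from bottom to top.  Two routes are incoherent at v when
    one of them is to the upper left of the other. *)
Definition cw v P Q : bool :=
  [&& visits P v, visits Q v, pre v P < pre v Q & suf v Q < suf v P].
Definition ncw P Q : Prop := forall v, ~~ cw v P Q.
Definition compatible P Q : Prop := ncw P Q /\ ncw Q P.
Definition compatible_family S : Prop := {in S &, forall P Q, ncw P Q}.
(** The edges of a route appear only as the pairs of consecutive vertices on
    it: two routes share the edge between such a pair iff they agree there. *)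
Definition consecutive u v R : Prop :=
  [/\ visits R u, visits R v, pos u < pos v
    & forall x, visits R x -> pos x <= pos u \/ pos v <= pos x].
Definition covering S : Prop := forall R u v, consecutive u v R ->
  exists2 Z, Z \in S & agrees u v R Z.
Definition maximal_family C : Prop :=
  compatible_family C /\ forall X, (forall Y, Y \in C -> compatible X Y) -> X \in C.
(** T and B are consecutive points of the staircase of S at v. *)
Definition adjacent S v T B : Prop :=
  [/\ [/\ T \in S, B \in S, visits T v & visits B v], T != B,
      pre v T <= pre v B /\ suf v T <= suf v B
    & forall Y, Y \in S -> visits Y v ->
        (pre v Y <= pre v T /\ suf v Y <= suf v T) \/
        (pre v B <= pre v Y /\ suf v B <= suf v Y)].
Definition saturated S : Prop := forall v T B, adjacent S v T B ->
  pre v T = pre v B \/ suf v T = suf v B.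
(** R is an upper left corner: the staircase rises from P to R and then goes to
    the right, from R to Q. *)
Definition corner S v P R Q : Prop :=
  [/\ adjacent S v P R, adjacent S v R Q, pre v P = pre v R & suf v R = suf v Q].
(** The staircases of D lie, weakly, to the lower right of those of C. *)
Definition below C D : Prop := {in C & D, forall R R', ncw R' R}.

Lemma agrees_eq_pre u v P Q : agrees u v P Q -> pre u P = pre u Q <-> pre v P = pre v Q.
Proof. by move=> h; have := agrees_pre h; have := agrees_pre (agrees_sym h); lia. Qed.

Lemma agrees_eq_suf u v P Q : agrees u v P Q -> suf u P = suf u Q <-> suf v P = suf v Q.
Proof. by move=> h; have := agrees_suf h; have := agrees_suf (agrees_sym h); lia. Qed.

Lemma cwP v P Q : visits P v -> visits Q v ->
  ~~ cw v P Q <-> (pre v P < pre v Q -> suf v P <= suf v Q).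
Proof. by move=> tP tQ; rewrite /cw tP tQ /=; split; lia. Qed.

Lemma family_chain S v P Q : compatible_family S -> P \in S -> Q \in S ->
  visits P v -> visits Q v ->
  (pre v P <= pre v Q /\ suf v P <= suf v Q) \/ (pre v Q <= pre v P /\ suf v Q <= suf v P).
Proof.
move=> cS PS QS tP tQ.
have /(cwP tP tQ) := cS P Q PS QS v; have /(cwP tQ tP) := cS Q P QS PS v; lia.
Qed.

(** X and T have the same prefix up to v.  If Y leaves X before v, it compares
    with X at y as with T; otherwise it reaches v along X, and the comparison at
    y is the comparison at v. *)
Lemma cw_before y v X T Y : pos y <= pos v -> visits X v -> visits T v ->
  pre v X = pre v T ->
  (cw y X Y -> cw y T Y \/ agrees y v X Y /\ cw v X Y) /\
  (cw y Y X -> cw y Y T \/ agrees y v X Y /\ cw v Y X).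
Proof.
move=> yv tX tT aXT; rewrite /cw tX; split=> /and4P[tXy tYy aXY bYX].
  have g := pre_agrees aXT tX tT yv tXy; have [_ _ _ tTy _] := agrees_visits g.
  have aXTy := proj2 (agrees_eq_pre g) aXT; rewrite tTy tYy.
  have [_ /(_ bYX) [h|h]] := suf_diverge g tYy; [right|left; lia].
  by have [_ _ _ _ ->] := agrees_visits h; rewrite -(agrees_pre h) -(agrees_suf (agrees_sym h)) aXY.
have g := pre_agrees aXT tX tT yv tYy; have [_ _ _ tTy _] := agrees_visits g.
have aXTy := proj2 (agrees_eq_pre g) aXT; rewrite tTy tXy.
have [/(_ bYX) [h|h] _] := suf_diverge g tXy; [right|left; lia].
by have [_ _ _ _ ->] := agrees_visits h; rewrite -(agrees_pre (agrees_sym h)) -(agrees_suf h) aXY.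
Qed.

End Coherence.

Arguments cw {G}.

Lemma cw_swap (G : route_system) v (P Q : sroute G) : @cw (swap G) v P Q = @cw G v Q P.
Proof. by rewrite /cw /=; case: (visits P v); case: (visits Q v) => //=; rewrite andbC. Qed.

Section Gluing.
Variable G : route_system.
Implicit Types (P Q R T B X Y Z : sroute G) (u v w x y : svertex G) (S C D : {set sroute G}).

Lemma ncw_swap P Q : @ncw (swap G) P Q <-> @ncw G Q P.
Proof. by split=> h v; have := h v; rewrite cw_swap. Qed.

Lemma compatible_swap P Q : @compatible (swap G) P Q <-> @compatible G P Q.
Proof. by rewrite /compatible !ncw_swap; tauto. Qed.

Lemma family_swap S : @compatible_family (swap G) S <-> @compatible_family G S.
Proof.
by split=> h P Q PS QS; [rewrite -ncw_swap|rewrite ncw_swap]; apply: h.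
Qed.

Lemma maximal_family_swap S : @maximal_family (swap G) S <-> @maximal_family G S.
Proof.
rewrite /maximal_family family_swap; split=> -[cS mS]; split=> // X h; apply: mS => Y /h.
  by rewrite compatible_swap.
by rewrite compatible_swap.
Qed.

Lemma consecutive_swap u v R : @consecutive (swap G) u v R <-> @consecutive G v u R.
Proof.
by split=> -[tu tv /= uv h]; split=> //= [|x /h /=]; rewrite ?ltnNge ?copos_le -?ltnNge;
 move: uv; rewrite ?ltnNge ?copos_le -?ltnNge //; lia.
Qed.

Lemma covering_swap S : @covering (swap G) S <-> @covering G S.
Proof. by split=> h R u v uv; apply: (h R v u); apply/consecutive_swap. Qed.

Lemma adjacent_swap S v P Q : @adjacent (swap G) S v P Q <-> @adjacent G S v P Q.
Proof.
by split=> -[mem ne /= le h]; split=> //=; [tauto| |tauto|] => Y YS /(h Y YS) /=; tauto.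
Qed.

Lemma below_swap C D : @below (swap G) C D <-> @below G D C.
Proof.
by split=> h R R' RC RD; [rewrite -ncw_swap|rewrite ncw_swap]; apply: h.
Qed.

Lemma cw_after y v X T Y : pos v <= pos y -> visits X v -> visits T v ->
  suf v X = suf v T ->
  (cw y X Y -> cw y T Y \/ agrees v y X Y /\ cw v X Y) /\
  (cw y Y X -> cw y Y T \/ agrees v y X Y /\ cw v Y X).
Proof.
rewrite -copos_le => yv tX tT bXT.
by have /= := @cw_before (swap G) y v X T Y yv tX tT bXT; rewrite !cw_swap; tauto.
Qed.

(** An incoherence of the glued route X with Y at a vertex before v is one of T
    with Y, unless Y follows X to v; after v the same holds with B. *)
Lemma ncw_glue v X T B Y : visits X v -> visits T v -> visits B v ->
  pre v X = pre v T -> suf v X = suf v B ->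
  (ncw T Y -> ncw B Y -> ~~ cw v X Y -> ncw X Y) /\
  (ncw Y T -> ncw Y B -> ~~ cw v Y X -> ncw Y X).
Proof.
move=> tX tT tB aX bX.
have step y : (cw y X Y -> [\/ cw y T Y, cw y B Y | cw v X Y]) /\
              (cw y Y X -> [\/ cw y Y T, cw y Y B | cw v Y X]).
  case: (leqP (pos y) (pos v)) => [yv|/ltnW yv].
    have [h1 h2] := @cw_before _ y v X T Y yv tX tT aX.
    by split=> [/h1|/h2] [?|[_ ?]]; [constructor 1|constructor 3|constructor 1|constructor 3].
  have [h1 h2] := cw_after Y yv tX tB bX.
  by split=> [/h1|/h2] [?|[_ ?]]; [constructor 2|constructor 3|constructor 2|constructor 3].
split=> hT hB h y; apply/negP; have [s1 s2] := step y.
  by case/s1; apply/negP.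
by case/s2; apply/negP.
Qed.

Lemma compatible_glue v X T B Y : visits X v -> visits T v -> visits B v ->
  pre v X = pre v T -> suf v X = suf v B ->
  compatible T Y -> compatible B Y -> ~~ cw v X Y -> ~~ cw v Y X -> compatible X Y.
Proof.
move=> tX tT tB aX bX [] hT1 hT2 [hB1 hB2] h1 h2.
by have [k1 k2] := ncw_glue Y tX tT tB aX bX; split; auto.
Qed.

End Gluing.

(** * Staircases *)

Section Chains.
Variable G : route_system.
Implicit Types (P Q R T B X Y Z : sroute G) (u v w x y : svertex G) (S C D : {set sroute G}).

(** Strictly increasing along a staircase, hence a numerical substitute for the
    order of its points. *)
Definition level v P := pre v P + suf v P.

Lemma chain_lt S v P Q : compatible_family S -> P \in S -> Q \in S -> visits P v -> visits Q v ->
  level v P <= level v Q -> pre v P <= pre v Q /\ suf v P <= suf v Q.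
Proof.
by move=> cS PS QS tP tQ; have := family_chain cS PS QS tP tQ; rewrite /level; ord.
Qed.

Lemma chain_eq S v P Q : compatible_family S -> P \in S -> Q \in S -> visits P v -> visits Q v ->
  level v P = level v Q -> P = Q.
Proof.
move=> cS PS QS tP tQ; rewrite /level => e; apply: (route_ext v) => //;
  by have := family_chain cS PS QS tP tQ; ord.
Qed.

(** If both coordinates increased from T to B, the route with the prefix of T and
    the suffix of B would be comparable with the whole staircase at v, hence
    coherent with C by gluing, hence a point of C strictly between T and B. *)
Lemma maximal_family_saturated C : maximal_family C -> saturated C.
Proof.
move=> [cC mC] v T B [[TC BC tT tB] neTB [aTB bTB] h].
have [tX aX bX] := glueP tT tB; set X := glue v T B in tX aX bX.
have XC : X \in C.
  apply: mC => Y YC; apply: (compatible_glue tX tT tB aX bX).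
  - by split; apply: cC.
  - by split; apply: cC.
  - case tY: (visits Y v); last by rewrite /cw tY andbF.
    by apply/cwP => //; have := h Y YC tY; ord.
  - case tY: (visits Y v); last by rewrite /cw tY.
    by apply/cwP => //; have := h Y YC tY; ord.
by have := h X XC tX; ord.
Qed.

(** Going along a staircase from a point with property [low] to one without it,
    some single step loses the property. *)
Lemma saturated_step S v (low : pred (sroute G)) T0 B0 :
  compatible_family S -> T0 \in S -> B0 \in S -> visits T0 v -> visits B0 v ->
  low T0 -> ~~ low B0 -> level v T0 <= level v B0 ->
  exists T B, [/\ adjacent S v T B, low T, ~~ low B,
    pre v T0 <= pre v T /\ suf v T0 <= suf v T & pre v B <= pre v B0 /\ suf v B <= suf v B0].
Proof.
move=> cS T0S B0S tT0 tB0 lT0 lB0 le0.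
have [|B /and4P[BS tB nlB TB] Bmin] := @ex_argmin _
  [pred Y | [&& Y \in S, visits Y v, ~~ low Y & level v T0 <= level v Y]] (level v).
  by exists B0; rewrite /= B0S tB0 lB0.
have ltT0B : level v T0 < level v B.
  rewrite ltn_neqAle TB andbT; apply/eqP => /(chain_eq cS T0S BS tT0 tB) e.
  by move: nlB; rewrite -e lT0.
have [|T /and3P[TS tT ltTB] Tmax] := @ex_argmax _
  [pred Y | [&& Y \in S, visits Y v & level v Y < level v B]] (level v).
  by exists T0; rewrite /= T0S tT0.
have leT0T : level v T0 <= level v T by apply: Tmax; rewrite /= T0S tT0.
have leBB0 : level v B <= level v B0 by apply: Bmin; rewrite /= B0S tB0 lB0.
exists T, B; split.
- split=> //; first by apply: contraTneq ltTB => ->; rewrite ltnn.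
    by apply: (chain_lt cS) => //; apply: ltnW.
  move=> Y YS tY; case: (ltnP (level v Y) (level v B)) => hY.
    by left; apply: (chain_lt cS) => //; apply: Tmax; rewrite /= YS tY.
  by right; apply: (chain_lt cS).
- apply: contraLR ltTB => nlT; rewrite -leqNgt; apply: Bmin.
  by rewrite /= TS tT nlT.
- exact: nlB.
- exact: (chain_lt cS).
- exact: (chain_lt cS).
Qed.

Lemma next_vertex R v : visits R v -> v != sink G -> exists u, consecutive v u R.
Proof.
move=> tv nv.
have [|u /andP[tu vu] umin] := @ex_argmin _
  [pred x | visits R x & pos v < pos x] (@pos G).
  exists (sink G); rewrite /= visits_sink ltn_neqAle pos_sink andbT.
  by apply: contra nv => /eqP/pos_inj ->.
exists u; split=> // x tx; case: (ltnP (pos v) (pos x)) => h; last by left.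
by right; apply: umin; rewrite /= tx.
Qed.

End Chains.

Lemma prev_vertex (G : route_system) (R : sroute G) v :
  visits R v -> v != source G -> exists u, consecutive u v R.
Proof.
move=> tv nv; have [u] := @next_vertex (swap G) R v tv nv.
by exists u; apply/consecutive_swap.
Qed.

Section Splitting.
Variable G : route_system.
Implicit Types (P Q R T B X Y Z : sroute G) (u v w x y : svertex G) (S C D : {set sroute G}).

(** The route glued from P and Q at v has the prefix of P and the suffix of Q, so
    it agrees with both of them on the trivial interval at v. *)
Lemma agrees_diag v P Q : visits P v -> visits Q v -> agrees v v P Q.
Proof.
move=> tP tQ; have [tX aX bX] := glueP tP tQ.
apply: agrees_trans (agrees_sym (pre_agrees aX tX tP (leqnn _) tX)) _.
exact: (suf_agrees bX tX tQ (leqnn _) tX).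
Qed.

(** The vertex w is where P and Q merge for the last time before v.  Their edges
    into w differ; a route of S through the edge of P lies to the left of Q at w,
    and one through the edge of Q to the right of P. *)
Lemma split_in_cover S v P Q : covering S -> visits P v -> visits Q v ->
  pre v P < pre v Q -> exists w, [/\ agrees w v P Q,
    exists2 Z, Z \in S & visits Z w /\ pre w Z < pre w Q &
    exists2 Z, Z \in S & visits Z w /\ pre w P < pre w Z].
Proof.
move=> cS tP tQ lt.
have [|w /= gw wmin] := @ex_argmin _ [pred x | agrees x v P Q] (@pos G).
  by exists v; apply: agrees_diag.
have [wv tPw _ tQw _] := agrees_visits gw.
have ltw : pre w P < pre w Q by rewrite (agrees_pre gw).
have nw : w != source G by apply: contraTneq ltw => ->; rewrite (pre_source P Q) ltnn.
have nag u : pos u < pos w -> ~ agrees u w P Q.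
  by move=> uw h; have := wmin _ (agrees_cat h gw); ord.
have [u uP] := prev_vertex tPw nw; have [Z ZS gZ] := cS _ _ _ uP.
have [u' uQ] := prev_vertex tQw nw; have [Z' ZS' gZ'] := cS _ _ _ uQ.
exists w; split=> //.
  exists Z => //; have [_ _ _ _ tZ] := agrees_visits gZ; split=> //.
  have [/(_ ltw) [h|//] _] := pre_diverge gZ tQw.
  by case: (nag u) => //; case: uP.
exists Z' => //; have [_ _ _ _ tZ] := agrees_visits gZ'; split=> //.
have [_ /(_ ltw) [h|//]] := pre_diverge gZ' tPw.
by case: (nag u'); [case: uQ|apply: agrees_sym].
Qed.

End Splitting.

Lemma split_out_cover (G : route_system) (S : {set sroute G}) v P Q :
  covering S -> visits P v -> visits Q v ->
  suf v P < suf v Q -> exists w, [/\ agrees v w P Q,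
    exists2 Z, Z \in S & visits Z w /\ suf w Z < suf w Q &
    exists2 Z, Z \in S & visits Z w /\ suf w P < suf w Z].
Proof. by move=> /covering_swap cS; apply: (@split_in_cover (swap G)). Qed.

(** * Maximal families *)

Section Insertion.
Variable G : route_system.
Implicit Types (P Q R T B X Y Z : sroute G) (u v w x y : svertex G) (S C D : {set sroute G}).

(** The place of a given suffix in a staircase: after the last point below it, or
    else before the first point.  Combining the suffix with the prefix of that
    neighbour gives a pair comparable with the whole staircase. *)
Lemma insert_in C v X : compatible_family C -> (exists2 Y, Y \in C & visits Y v) ->
  exists T, [/\ T \in C, visits T v & forall Y, Y \in C -> visits Y v ->
    (pre v T < pre v Y -> suf v X <= suf v Y) /\ (pre v Y < pre v T -> suf v Y <= suf v X)].
Proof.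
move=> cC [Y0 Y0C tY0].
case: (boolP [exists Y in C, visits Y v && (suf v Y < suf v X)]) => [|nex].
  case/exists_inP=> Y1 Y1C /andP[tY1 ltY1].
  have [|T /and3P[TC tT ltT] Tmax] := @ex_argmax _
    [pred Y | [&& Y \in C, visits Y v & suf v Y < suf v X]] (level v).
    by exists Y1; rewrite /= Y1C tY1.
  exists T; split=> // Y YC tY; have := family_chain cC TC YC tT tY.
  have := Tmax Y; rewrite /= YC tY /level; case: (ltnP (suf v Y)) => [_ /(_ isT)|h _]; ord.
have [|T /andP[TC tT] Tmin] := @ex_argmin _
    [pred Y | (Y \in C) && visits Y v] (level v).
  by exists Y0; rewrite /= Y0C.
have hX Y : Y \in C -> visits Y v -> suf v X <= suf v Y.
  move=> YC tY; rewrite leqNgt; apply: contra nex => h.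
  by apply/exists_inP; exists Y; rewrite ?tY.
exists T; split=> // Y YC tY; have := family_chain cC TC YC tT tY.
by have := Tmin Y; rewrite /= YC tY /level => /(_ isT); have := hX Y YC tY; ord.
Qed.

End Insertion.

Lemma insert_out (G : route_system) (C : {set sroute G}) v X :
  compatible_family C -> (exists2 Y, Y \in C & visits Y v) ->
  exists T, [/\ T \in C, visits T v & forall Y, Y \in C -> visits Y v ->
    (suf v T < suf v Y -> pre v X <= pre v Y) /\ (suf v Y < suf v T -> pre v Y <= pre v X)].
Proof. by move=> /family_swap cC h; apply: (@insert_in (swap G)). Qed.

Section MaximalFamilies.
Variable G : route_system.
Implicit Types (P Q R T B X Y Z : sroute G) (u v w x y : svertex G) (S C D : {set sroute G}).

Lemma maximal_family_neq0 C : maximal_family C -> sroute G -> exists Y, Y \in C.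
Proof.
move=> [_ mC] R; case: (set_0Vmem C) => [C0|[Y YC]]; last by exists Y.
by exists R; apply: mC => Y; rewrite C0 inE.
Qed.

(** Given an edge (u, v) of a route R, let [v0] and [u0] be the nearest vertices
    of R, before and after the edge, that C visits.  Between them R meets no
    route of C, so only the ends matter: replacing the part of R before [v0] and
    the part after [u0] by parts of well chosen routes of C gives a route
    coherent with C, and it still uses the edge. *)
Lemma maximal_family_covering C : maximal_family C -> covering C.
Proof.
move=> mC R u v [tu tv uv nx]; have [cC maxC] := mC.
have [Y0 Y0C] := maximal_family_neq0 mC R.
have [|v0 /and3P[tv0 v0u /exists_inP vC] v0max] := @ex_argmax _
  [pred x | [&& visits R x, pos x <= pos u & [exists Y in C, visits Y x]]] (@pos G).
  exists (source G); rewrite /= visits_source pos_source; apply/exists_inP; exists Y0 => //.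
  exact: visits_source.
have [|u0 /and3P[tu0 vu0 /exists_inP uC] u0min] := @ex_argmin _
  [pred x | [&& visits R x, pos v <= pos x & [exists Y in C, visits Y x]]] (@pos G).
  exists (sink G); rewrite /= visits_sink pos_sink; apply/exists_inP; exists Y0 => //.
  exact: visits_sink.
have [T' [T'C tT' hT']] := insert_out R cC uC.
have [t2 a2 b2] := glueP tu0 tT'; set R2 := glue u0 R T' in t2 a2 b2.
have g2 x : visits R x -> pos x <= pos u0 -> agrees x u0 R R2.
  by move=> tx xu; apply: pre_agrees => //.
have t2v0 : visits R2 v0 by have [|_ _ _ ->] := agrees_visits (g2 v0 tv0 _) => //; ord.
have [T [TC tT hT]] := insert_in R2 cC vC.
have [t1 a1 b1] := glueP tT t2v0; set R1 := glue v0 T R2 in t1 a1 b1.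
exists R1.
  apply: maxC => Y YC.
  have nR1 : ~~ cw v0 R1 Y /\ ~~ cw v0 Y R1.
    case tY: (visits Y v0); last by rewrite /cw tY andbF.
    by have := hT Y YC tY; split; apply/cwP => //; rewrite a1 b1; ord.
  have nR2 : ~~ cw u0 R2 Y /\ ~~ cw u0 Y R2.
    case tY: (visits Y u0); last by rewrite /cw tY andbF.
    by have := hT' Y YC tY; split; apply/cwP => //; rewrite a2 b2; ord.
  have late y : pos v0 < pos y -> visits R2 y -> visits Y y -> pos u0 <= pos y.
    move=> vy t2y tYy; rewrite leqNgt; apply/negP => yu.
    have [|h _] := agrees_sub (agrees_sym (g2 v0 tv0 _)) t2y (ltnW vy) (ltnW yu); first ord.
    have [_ _ _ _ tRy] := agrees_visits h.
    have vis : [exists Z in C, visits Z y] by apply/exists_inP; exists Y.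
    case: (nx y tRy) => yle.
      by have := v0max y; rewrite /= tRy yle vis => /(_ isT); ord.
    by have := u0min y; rewrite /= tRy yle vis => /(_ isT); ord.
  have nTY := cC T Y TC YC; have nYT := cC Y T YC TC.
  have nTY' := cC T' Y T'C YC; have nYT' := cC Y T' YC T'C.
  have step y : ~~ cw y R1 Y /\ ~~ cw y Y R1.
    case: (leqP (pos y) (pos v0)) => yv0.
      have [h1 h2] := cw_before Y yv0 t1 tT a1.
      split; apply/negP; [move/h1|move/h2]; case=> [|[_]]; apply/negP => //;
        by case: nR1.
    have [h1 h2] := cw_after Y (ltnW yv0) t1 t2v0 b1.
    have u0y : visits R2 y -> visits Y y -> pos u0 <= pos y by exact: late.
    split; apply/negP; [move/h1|move/h2]; case=> [|[_]];
      try by apply/negP; case: nR1.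
      move=> h; case/and4P: (h) => t2y tYy _ _.
      have [/(_ h) k _] := cw_after Y (u0y t2y tYy) t2 tT' b2.
      by case: k => [|[_]]; apply/negP; [|case: nR2].
    move=> h; case/and4P: (h) => tYy t2y _ _.
    have [_ /(_ h) k] := cw_after Y (u0y t2y tYy) t2 tT' b2.
    by case: k => [|[_]]; apply/negP; [|case: nR2].
  by split=> y; case: (step y).
have v0u0 : pos v0 <= pos u0 by ord.
have g1 : agrees v0 u0 R2 R1.
  have [_ _ _ _ t] := agrees_visits (g2 v0 tv0 v0u0).
  exact: (suf_agrees (esym b1) t2v0 t1 v0u0 t).
have uu0 : pos u <= pos u0 by ord.
have [g _] := agrees_sub (g2 u tu uu0) tv (ltnW uv) vu0.
have [_ _ _ t2u t2v] := agrees_visits g.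
have [_ g'] := agrees_sub g1 t2u v0u uu0.
by have [g'' _] := agrees_sub g' t2v (ltnW uv) vu0; apply: agrees_trans g''.
Qed.

(** Suppose R'' of E is to the upper left of R of C at v, and let w be the vertex
    where they merge.  Every point of the staircase of D at w is either weakly
    to the lower left of both routes or weakly to the upper right of both.  Both
    kinds occur, since D covers the two edges into w, so some step of the
    staircase passes from the first kind to the second and increases both
    coordinates, against saturation. *)
Lemma below_trans C D E : maximal_family C -> maximal_family D -> maximal_family E ->
  below C D -> below D E -> below C E.
Proof.
move=> mC mD mE CD DE R R'' RC RE v; apply/negP => /and4P[tR'' tR ltA ltB].
have [cD _] := mD.
have [w [g [Y1 Y1D [tY1 aY1]] [Y2 Y2D [tY2 aY2]]]] :=
  split_in_cover (maximal_family_covering mD) tR'' tR ltA.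
have [_ tR''w _ tRw _] := agrees_visits g.
have {}ltA : pre w R'' < pre w R by rewrite (agrees_pre g).
have {}ltB : suf w R < suf w R'' by rewrite (agrees_suf (agrees_sym g)).
have dich Y : Y \in D -> visits Y w -> (pre w Y < pre w R -> suf w Y <= suf w R) /\
    (pre w R'' < pre w Y -> suf w R'' <= suf w Y).
  move=> YD tY; split.
    by move/(cwP tY tRw): (CD R Y RC YD w).
  by move/(cwP tR''w tY): (DE Y R'' YD RE w).
have [T [B [adjTB /= lT lB _ _]]] := @saturated_step _ D w
  [pred Y | suf w Y <= suf w R] Y1 Y2 cD Y1D Y2D tY1 tY2
  ltac:(have := dich _ Y1D tY1; rewrite /=; ord)
  ltac:(have := dich _ Y2D tY2; rewrite /=; ord)
  ltac:(have := dich _ Y1D tY1; have := dich _ Y2D tY2;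
        have := family_chain cD Y1D Y2D tY1 tY2; rewrite /level; ord).
have [[TD BD tT tB] _ _ _] := adjTB.
have := maximal_family_saturated mD adjTB; have := dich T TD tT; have := dich B BD tB.
ord.
Qed.

End MaximalFamilies.

(** * Corners and flips *)

Section Flips.
Variable G : route_system.
Implicit Types (P Q R T B X Y Z : sroute G) (u v w x y : svertex G) (S C D : {set sroute G}).

(** The lower right corner [glue v Q P] replaces the upper left one. *)
Definition flip v P R Q C : {set sroute G} := glue v Q P |: C :\ R.

Lemma corner_visits C v P R Q : corner C v P R Q -> [/\ visits P v, visits R v & visits Q v].
Proof. by case=> -[[_ _ tP tR] _ _ _] [[_ _ _ tQ] _ _ _] _ _. Qed.

Lemma corner_mem C v P R Q : corner C v P R Q ->
  [/\ P \in C :\ R, R \in C & Q \in C :\ R].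
Proof.
case=> -[[PC RC _ _] nPR _ _] [[_ QC _ _] nRQ _ _] _ _.
by rewrite !inE PC QC RC nPR eq_sym nRQ.
Qed.

Lemma corner_lt C v P R Q : corner C v P R Q ->
  [/\ suf v P < suf v R, pre v R < pre v Q, pre v P = pre v R & suf v R = suf v Q].
Proof.
case=> -[[PC RC tP tR] nPR [aPR bPR] _] [[_ QC _ tQ] nRQ [aRQ bRQ] _] ePR eRQ.
have nb : suf v P <> suf v R.
  by move=> e; move: nPR; rewrite (route_ext v tP tR ePR e) eqxx.
have na : pre v R <> pre v Q.
  by move=> e; move: nRQ; rewrite (route_ext v tR tQ e eRQ) eqxx.
by split=> //; ord.
Qed.

Lemma corner_between C v P R Q Y : corner C v P R Q -> Y \in C -> visits Y v ->
  [\/ pre v Y <= pre v P /\ suf v Y <= suf v P, Y = R |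
      pre v Q <= pre v Y /\ suf v Q <= suf v Y].
Proof.
move=> cor; have [bPR aRQ ePR eRQ] := corner_lt cor.
have [tP tR tQ] := corner_visits cor; case: cor => -[_ _ _ h1] [_ _ _ h2] _ _ YC tY.
have [k1|k1] := h1 Y YC tY; first by constructor 1.
have [k2|k2] := h2 Y YC tY; last by constructor 3.
by constructor 2; apply: (route_ext v) => //; ord.
Qed.

Lemma not_cw v P Q :
  (visits P v -> visits Q v -> pre v P < pre v Q -> suf v P <= suf v Q) -> ~~ cw v P Q.
Proof.
by move=> h; apply/negP => /and4P[tP tQ aPQ]; have := h tP tQ aPQ; ord.
Qed.

Lemma compatible_sym P Q : compatible P Q -> compatible Q P.
Proof. by case. Qed.

(** The last clause, that only R and the new corner complete C minus R, makes
    the flip unique and the result maximal.  A route Y coherent with P and Q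
    can be incoherent with R at v only, by gluing, because R is itself glued from
    P and Q.  There Y lies in the rectangle spanned by P and Q; if it were not
    its lower right corner, gluing Y with Q or with P would give a point of C on
    one of the steps from P to R to Q. *)
Lemma flipP C v P R Q : maximal_family C -> corner C v P R Q ->
  [/\ maximal_family (flip v P R Q C), glue v Q P \notin C, cw v R (glue v Q P),
      below C (flip v P R Q C) &
      forall Y, {in C :\ R, forall Z, compatible Y Z} -> Y \in glue v Q P |: C].
Proof.
move=> [cC mC] cor; have [bPR aRQ ePR eRQ] := corner_lt cor.
have [tP tR tQ] := corner_visits cor; have [PS RC QS] := corner_mem cor.
have [PC QC] : P \in C /\ Q \in C by case/setD1P: PS; case/setD1P: QS.
have btw := corner_between cor.
rewrite /flip; move: (glue v Q P) (glueP tQ tP) => X [tX aX bX].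
have cohC Z Y : Z \in C -> Y \in C -> compatible Z Y by move=> ZC YC; split; apply: cC.
have cRX : cw v R X by rewrite /cw tR tX aX bX; ord.
have XnC : X \notin C.
  by apply: contraTN cRX => XC; apply: cC.
have btw' Y : Y \in C :\ R -> visits Y v ->
    pre v Y <= pre v P /\ suf v Y <= suf v P \/ pre v Q <= pre v Y /\ suf v Q <= suf v Y.
  case/setD1P=> nYR YC tY; have [?|e|?] := btw Y YC tY; [by left| |by right].
  by rewrite e eqxx in nYR.
have cohX Y : Y \in C :\ R -> compatible X Y.
  move=> YS; have [_ YC] := setD1P YS.
  apply: (compatible_glue tX tQ tP aX bX); [exact: cohC|exact: cohC| |].
    by apply: not_cw => _ tY; have := btw' Y YS tY; ord.
  by apply: not_cw => tY _; have := btw' Y YS tY; ord.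
(* R is glued from P and Q, so coherence with R is tested at v alone *)
have fill Z : {in C :\ R, forall W, compatible Z W} -> ~~ cw v R Z -> ~~ cw v Z R ->
    Z \in C.
  move=> hZ h1 h2; apply: mC => W WC; case: (eqVneq W R) => [->|nWR].
    apply: compatible_sym; apply: (compatible_glue tR tP tQ (esym ePR) eRQ) => //;
      by apply: compatible_sym; apply: hZ.
  by apply: hZ; rewrite !inE nWR.
have uniq Y : {in C :\ R, forall Z, compatible Y Z} -> Y \in X |: C.
  move=> hY; apply/setU1P; case YC: (Y \in C); [by right|left].
  have tYb : visits Y v /\ (cw v R Y \/ cw v Y R).
    case c1: (cw v R Y); first by split; [case/and4P: c1|left].
    case c2: (cw v Y R); first by split; [case/and4P: c2|right].
    by have := fill Y hY; rewrite c1 c2 YC => /(_ isT isT).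
  have [tY cY] := tYb.
  have [/(_ v)/(cwP tY tP) h1 /(_ v)/(cwP tP tY) h2] := hY P PS.
  have [/(_ v)/(cwP tY tQ) h3 /(_ v)/(cwP tQ tY) h4] := hY Q QS.
  have [aPY bYQ aYQ bPY] : [/\ pre v P < pre v Y, suf v Y < suf v Q, pre v Y <= pre v Q
      & suf v P <= suf v Y].
    by case: cY => /and4P[_ _ k1 k2]; split; ord.
  apply: (route_ext v) => //; rewrite ?aX ?bX.
    apply/eqP; rewrite eqn_leq aYQ leqNgt; apply/negP => lt.
    (* a point of C on the step from R to Q *)
    move: (glue v Y Q) (glueP tY tQ) => Z [tZ aZ bZ].
    have ZC : Z \in C.
      apply: fill; last by apply: not_cw; ord.
        move=> W WS; have [_ WC] := setD1P WS.
        apply: (compatible_glue tZ tY tQ aZ bZ); [exact: hY|exact: cohC| |].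
          by apply: not_cw => _ tW; have := btw' W WS tW; ord.
        by apply: not_cw => tW _; have := btw' W WS tW; ord.
      by apply: not_cw; ord.
    have [k|k|k] := btw Z ZC tZ; [ord| |ord].
    by rewrite k in aZ; ord.
  apply/eqP; rewrite eqn_leq bPY andbT leqNgt; apply/negP => lt.
  (* a point of C on the step from P to R *)
  move: (glue v P Y) (glueP tP tY) => Z [tZ aZ bZ].
  have ZC : Z \in C.
    apply: fill; last by apply: not_cw; ord.
      move=> W WS; have [_ WC] := setD1P WS.
      apply: (compatible_glue tZ tP tY aZ bZ); [exact: cohC|exact: hY| |].
        by apply: not_cw => _ tW; have := btw' W WS tW; ord.
      by apply: not_cw => tW _; have := btw' W WS tW; ord.
    by apply: not_cw; ord.
  have [k|k|k] := btw Z ZC tZ; [ord| |ord].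
  by rewrite k in bZ; ord.
split=> //.
- split.
    move=> Y Z; case/setU1P=> [->|YS]; case/setU1P=> [->|ZS].
    + by move=> w; apply: not_cw; ord.
    + by have [] := cohX Z ZS.
    + by have [] := cohX Y YS.
    + by apply: cC; [case/setD1P: YS|case/setD1P: ZS].
  move=> Y hY; apply/setU1P.
  have /uniq/setU1P[->|YC] : {in C :\ R, forall Z, compatible Y Z}; [|by left|right].
    by move=> Z ZS; apply: hY; apply: setU1r.
  rewrite !inE YC andbT; apply: contraTneq cRX => <-.
  by have [h1 _] := hY X (setU11 _ _).
- move=> Y Z YC /setU1P[->|/setD1P[_ ZC]]; last exact: cC.
  case: (eqVneq Y R) => [->|nYR].
    have [h _] := ncw_glue R tX tQ tP aX bX.
    by apply: h; [exact: cC|exact: cC|apply/cwP => //; ord].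
  by have [|] := cohX Y; rewrite ?inE ?nYR.
Qed.

End Flips.

Section Corners.
Variable G : route_system.
Implicit Types (P Q R T B X Y Z : sroute G) (u v w x y : svertex G) (S C D : {set sroute G}).

Lemma adjacent_succ S v R Z : compatible_family S -> R \in S -> Z \in S -> visits R v ->
  visits Z v -> level v R < level v Z -> exists2 Q, adjacent S v R Q & level v Q <= level v Z.
Proof.
move=> cS RS ZS tR tZ lt.
have [|||T [B [h /= lT lB l1 l2]]] := @saturated_step _ S v
  [pred Y | level v Y <= level v R] R Z cS RS ZS tR tZ; rewrite /= -?ltnNge ?(ltnW lt) //.
have eT : T = R.
  case: (h) => -[TS BS tT tB] _ _ _; apply: (chain_eq cS TS RS tT tR).
  by apply/eqP; rewrite eqn_leq lT /=; move: l1; rewrite /level; ord.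
by exists B; [rewrite -eT|rewrite /level; ord].
Qed.

Lemma adjacent_pred S v R Z : compatible_family S -> R \in S -> Z \in S -> visits R v ->
  visits Z v -> level v Z < level v R -> exists2 P, adjacent S v P R & level v Z <= level v P.
Proof.
move=> cS RS ZS tR tZ lt.
have [|||T [B [h /= lT lB l1 l2]]] := @saturated_step _ S v
  [pred Y | level v Y < level v R] Z R cS ZS RS tZ tR; rewrite /= ?ltnn // ?(ltnW lt) //.
have eB : B = R.
  case: (h) => -[TS BS tT tB] _ _ _; apply: (chain_eq cS BS RS tB tR).
  by move: l2 lB; rewrite /level; ord.
by exists T; [rewrite -eB|rewrite /level; ord].
Qed.

(** If X replaces R, with R to the upper left of X at z, then R is a corner at the
    end of the common part of R and X that contains z.  The edges of X entering and leaving
    their common part are covered by C, so the staircase of C continues on both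
    sides of R there; coherence with X makes the step after R go to the right and
    the step before R go up. *)
Lemma rotation_corner C R X z : maximal_family C -> R \in C -> maximal_family (X |: C :\ R) ->
  cw z R X -> exists v P Q, corner C v P R Q.
Proof.
move=> mC RC [cC' _] cz; have [cC _] := mC.
have satC := maximal_family_saturated mC; have covC := maximal_family_covering mC.
have cohX Y : Y \in C :\ R -> ncw Y X /\ ncw X Y.
  by move=> YS; split; apply: cC'; rewrite ?setU11 // setU1r.
have [tR tX ltA ltB] := and4P cz.
have succ w : agrees w z R X \/ agrees z w R X -> forall Z, Z \in C -> visits Z w ->
    pre w R < pre w Z -> exists Q, [/\ adjacent C w R Q, pre w R < pre w Q & suf w R = suf w Q].
  move=> g Z ZC tZ lt.
  have [tRw tXw aRX bXR] : [/\ visits R w, visits X w, pre w R < pre w X & suf w X < suf w R].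
    case: g => g; have [_ t1 t2 t3 t4] := agrees_visits g; split=> //.
    - by rewrite (agrees_pre g).
    - by rewrite (agrees_suf (agrees_sym g)).
    - by rewrite -(agrees_pre g).
    - by rewrite -(agrees_suf (agrees_sym g)).
  have ltc : level w R < level w Z.
    by have := family_chain cC RC ZC tRw tZ; rewrite /level; ord.
  have [Q aRQ _] := adjacent_succ cC RC ZC tRw tZ ltc; have sRQ := satC _ _ _ aRQ.
  have [[_ QC _ tQ] nRQ [leA leB] _] := aRQ.
  have [|/(_ w)/(cwP tQ tXw) h _] := cohX Q; first by rewrite !inE eq_sym nRQ.
  by exists Q; split=> //; ord.
have [w [g _ [Z ZC [tZ aZ]]]] := split_in_cover covC tR tX ltA.
have [Q [[[_ QC _ tQ] _ _ _] aRQ bRQ]] := succ w (or_introl g) Z ZC tZ aZ.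
have [w' [g' [Z' Z'C [tZ' bZ']] _]] := split_out_cover covC tX tR ltB.
have [wz tRw tRz tXw _] := agrees_visits g.
have [zw' tXz tXw' _ tRw'] := agrees_visits g'.
have h : agrees w w' R Q := suf_agrees bRQ tRw tQ (leq_trans wz zw') tRw'.
have [_ _ _ _ tQw'] := agrees_visits h.
have aRQ' : pre w' R < pre w' Q by rewrite -(agrees_pre h).
have [Q1 [adjQ1 aRQ1 bRQ1]] := succ w' (or_intror (agrees_sym g')) Q QC tQw' aRQ'.
have ltc : level w' Z' < level w' R.
  by have := family_chain cC RC Z'C tRw' tZ'; rewrite /level; ord.
have [P adjP _] := adjacent_pred cC RC Z'C tRw' tZ' ltc; have sP := satC _ _ _ adjP.
have [[PC _ tP _] nPR [leA leB] _] := adjP.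
have aRX : pre w' R < pre w' X by rewrite -(agrees_pre (agrees_sym g')).
have bXR : suf w' X < suf w' R by rewrite -(agrees_suf g').
have [|/(_ w')/(cwP tP tXw') k _] := cohX P; first by rewrite !inE nPR.
by exists w', P, Q1; split=> //; ord.
Qed.

(** If u is before v, the predecessor of R at u shares the suffix of R, so it also
    passes through v and is to the left of R there, on the same level; but the
    point before R at v is below R.  The other case is symmetric. *)
Lemma corner_not_both C R u v P Q P' Q' : corner C v P R Q ->
  @corner (swap G) C u P' R Q' -> False.
Proof.
move=> k k'; have /= [bPR aRQ ePR eRQ] := corner_lt k.
have /= [aPR' bRQ' ePR' eRQ'] := corner_lt k'.
have [tP tR tQ] := corner_visits k; have /= [tP' tR' tQ'] := corner_visits k'.
have [PC RC QC] := corner_mem k; have [P'C _ Q'C] := corner_mem k'.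
case: (leqP (pos u) (pos v)) => uv.
  have h := suf_agrees (esym ePR') tR' tP' uv tR; have [_ _ _ _ tP'v] := agrees_visits h.
  have lt : pre v P' < pre v R by rewrite -(agrees_pre (agrees_sym h)).
  have eb := proj1 (agrees_eq_suf h) (esym ePR').
  have P'C' : P' \in C by case/setD1P: P'C.
  case: (corner_between k P'C' tP'v); [ord| |ord].
  by move=> e; rewrite e ltnn in lt.
have h := suf_agrees eRQ tR tQ (ltnW uv) tR'; have [_ _ _ _ tQu] := agrees_visits h.
have lt : pre u R < pre u Q by rewrite -(agrees_pre h).
have eb := proj1 (agrees_eq_suf h) eRQ.
have QC' : Q \in C by case/setD1P: QC.
case: (@corner_between (swap G) C u P' R Q' Q k' QC' tQu) => /=; [ord| |ord].
by move=> e; rewrite e ltnn in lt.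
Qed.

(** Suppose that every route of C through the edge (u, v) is a corner.  A corner
    located before the edge has a successor on the same level, which also uses
    the edge; a corner located after it has a predecessor with the same prefix,
    which also uses the edge.  So the first kind is never last and the second
    kind never first; where the kind changes from the first to the second, the
    two neighbours would share their suffix and their prefix. *)
Lemma covering_setD C S : maximal_family C ->
  {in C :\: S, forall R, exists v P Q, corner C v P R Q} ->
  S \subset C -> covering S.
Proof.
move=> mC hcor SC R u v uv; have [cC _] := mC; have [tu tv lt nx] := uv.
case: (boolP [exists Y in S, agrees u v R Y]) => [/exists_inP[Y]|nS]; first by exists Y.
exfalso.
pose E Y := (Y \in C) && agrees u v R Y.
have EP Y : E Y -> [/\ Y \in C, agrees u v R Y, visits Y u & visits Y v].
  by case/andP=> YC g; have [_ _ _ ? ?] := agrees_visits g.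
have E0 : exists Y, E Y.
  by have [Z ZC g] := maximal_family_covering mC uv; exists Z; rewrite /E ZC.
have Ecor Y : E Y -> exists x P Q, corner C x P Y Q /\
    (pos x <= pos u \/ pos v <= pos x).
  move=> EY; have [YC g tYu tYv] := EP Y EY.
  have [|x [P [Q k]]] := hcor Y.
    by rewrite inE YC andbT; apply: contra nS => YS; apply/exists_inP; exists Y.
  exists x, P, Q; split=> //; have [_ tYx _] := corner_visits k.
  case: (leqP (pos x) (pos u)) => [|ux]; first by left.
  case: (leqP (pos v) (pos x)) => [|xv]; first by right.
  have [h _] := agrees_sub (agrees_sym g) tYx (ltnW ux) (ltnW xv).
  have [_ _ _ _ tRx] := agrees_visits h; case: (nx x tRx); ord.
have early x P Y Q : E Y -> corner C x P Y Q -> pos x <= pos u ->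
    [/\ E Q, pre u Y < pre u Q & suf u Y = suf u Q].
  move=> EY k xu; have [YC g tYu tYv] := EP Y EY.
  have [_ tYx tQx] := corner_visits k; have [_ _ QC] := corner_mem k.
  have [_ aYQ _ bYQ] := corner_lt k.
  have h := suf_agrees bYQ tYx tQx (leq_trans xu (ltnW lt)) tYv.
  have [h1 h2] := agrees_sub h tYu xu (ltnW lt).
  split; last by apply: (proj1 (agrees_eq_suf h1)).
    by rewrite /E; case/setD1P: QC => _ ->; apply: agrees_trans h2.
  by rewrite -(agrees_pre h1).
have late x P Y Q : E Y -> corner C x P Y Q -> pos v <= pos x ->
    [/\ E P, suf u P < suf u Y & pre u P = pre u Y].
  move=> EY k svertex; have [YC g tYu tYv] := EP Y EY.
  have [tPx tYx _] := corner_visits k; have [PC _ _] := corner_mem k.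
  have [bPY _ aPY _] := corner_lt k.
  have h := pre_agrees (esym aPY) tYx tPx (leq_trans (ltnW lt) svertex) tYu.
  have [h1 h2] := agrees_sub h tYv (ltnW lt) svertex.
  split; last by symmetry; apply: (proj2 (agrees_eq_pre h)).
    by rewrite /E; case/setD1P: PC => _ ->; apply: agrees_trans h1.
  by rewrite (agrees_suf (agrees_sym h)).
(* B is the first corner of the second kind, A the last point before it *)
pose e Y := `[< exists x P Q, corner C x P Y Q /\ pos x <= pos u >].
have eQ Y : E Y -> e Y -> exists Q, [/\ E Q, pre u Y < pre u Q & suf u Y = suf u Q].
  by move=> EY /asboolP[x [P [Q [k xu]]]]; exists Q; apply: early k xu.
have nP Y : E Y -> ~~ e Y -> exists P, [/\ E P, suf u P < suf u Y & pre u P = pre u Y].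
  move=> EY /asboolPn ne; have [x [P [Q [k [xu|svertex]]]]] := Ecor Y EY.
    by case: ne; exists x, P, Q.
  by exists P; apply: late k svertex.
have chainE Y Z : E Y -> E Z -> level u Y <= level u Z -> pre u Y <= pre u Z /\ suf u Y <= suf u Z.
  by move=> /EP[YC _ tY _] /EP[ZC _ tZ _]; apply: chain_lt cC YC ZC tY tZ.
have [B0 EB0 B0max] := @ex_argmax _ E (level u) E0.
have neB0 : ~~ e B0.
  apply/negP => /(eQ _ EB0)[Q [EQ aQ bQ]].
  by have := B0max Q EQ; rewrite /level; ord.
have [|B /andP[EB neB] Bmin] := @ex_argmin _ [pred Y | E Y & ~~ e Y] (level u).
  by exists B0; rewrite /= EB0.
have [P [EP' bPB aPB]] := nP B EB neB.
have [|A /andP[EA ltA] Amax] := @ex_argmax _ [pred Y | E Y & level u Y < level u B] (level u).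
  by exists P; rewrite /= EP' /level; ord.
have eA : e A.
  by apply: contraTT ltA => neA; rewrite -leqNgt; apply: Bmin; rewrite /= EA.
have [Q [EQ aAQ bAQ]] := eQ A EA eA.
have leBQ : level u B <= level u Q.
  rewrite leqNgt; apply/negP => lt'; have := Amax Q; rewrite /= EQ lt' /level.
  by move=> /(_ isT); ord.
have lePA : level u P <= level u A by apply: Amax; rewrite /= EP' /level; ord.
have := chainE _ _ EB EQ leBQ; have := chainE _ _ EP' EA lePA.
have := chainE _ _ EA EB (ltnW ltA); move: ltA; rewrite /level; ord.
Qed.

End Corners.

(** * The vertex where a route leaves a family *)

Section Departure.
Variable G : route_system.
Implicit Types (P Q R T B X Y Z : sroute G) (u v w x y : svertex G) (S C D : {set sroute G}).

Definition shares S R x : Prop :=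
  exists T, [/\ T \in S, visits T x & pre x T = pre x R].

(** R leaves, along its edge from v to u, the tree of the prefixes of S. *)
Definition departs S R v u : Prop :=
  [/\ consecutive v u R, shares S R v
    & forall x, visits R x -> shares S R x -> pos x <= pos v].

Lemma departure S R Y : covering S -> Y \in S -> R \notin S ->
  exists v u, departs S R v u.
Proof.
move=> covS YS RS.
have [|v /andP[tv /asboolP[T [TS tT eT]]] vmax] := @ex_argmax _
  [pred x | visits R x && `[< shares S R x >]] (@pos G).
  exists (source G); rewrite /= visits_source; apply/asboolP; exists Y.
  by split=> //; [exact: visits_source|exact: pre_source].
have nv : v != sink G.
  apply: contraNneq RS => ev; rewrite ev in tv tT eT.
  by rewrite -(route_ext (sink G) tT tv eT (suf_sink T R)).
have [u vu] := next_vertex tv nv.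
exists v, u; split=> // [|x tx hx]; first by exists T.
by apply: vmax; rewrite /= tx; apply/asboolP.
Qed.

(** Y leaves v by an edge above (for [low], below) the edge of R from v to u. *)
Definition high v u R Y := (~~ agrees v u R Y) && (suf v R < suf v Y).
Definition low v u R Y := (~~ agrees v u R Y) && (suf v Y < suf v R).

Section Departs.
Variables (S : {set sroute G}) (R : sroute G) (v u : svertex G).
Hypotheses (cS : compatible_family S) (covS : covering S) (dep : departs S R v u).

Lemma departs_fork Y : Y \in S -> visits Y v -> pre v Y = pre v R -> ~~ agrees v u R Y.
Proof.
case: dep => -[tv tu vu _] _ vmax YS tY eY; apply/negP => g.
have [_ _ _ _ tYu] := agrees_visits g; have := vmax u tu.
have h : shares S R u by exists Y; split=> //; apply/esym/(agrees_eq_pre g).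
by move/(_ h); ord.
Qed.

Lemma departs_visits : visits R v /\ pos v < pos u.
Proof. by case: dep => -[]. Qed.

Lemma departs_middle : exists Z, [/\ Z \in S, visits Z v & agrees v u R Z].
Proof.
case: dep => vu _ _; have [Z ZS g] := covS vu; exists Z; split=> //.
by have [_ _ _ ? _] := agrees_visits g.
Qed.

Lemma middle_lt Y Z : visits Y v -> agrees v u R Z -> ~~ agrees v u R Y ->
  (suf v Y < suf v R -> suf v Y < suf v Z) /\ (suf v R < suf v Y -> suf v Z < suf v Y).
Proof.
move=> tY g ng; have [h1 h2] := suf_diverge g tY; split.
  by case/h2 => // h; rewrite h in ng.
by case/h1 => // h; rewrite h in ng.
Qed.

(** A route with the prefix of R at v cannot use the edge (v, u), so it leaves v
    above or below R.  The two cases are treated separately below. *)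
Lemma departs_low_high : exists T,
  [/\ T \in S, visits T v, pre v T = pre v R & low v u R T \/ high v u R T].
Proof.
case: (dep) => -[tv tu vu _] [T [TS tT eT]] _; exists T; split=> //.
have ng := departs_fork TS tT eT; rewrite /low /high ng /=.
case: (ltngtP (suf v T) (suf v R)) => [||e]; [by left|by right|].
case/negP: ng; apply: suf_agrees (esym e) tv tT (ltnW vu) tu.
Qed.

(** The witness is the first point of the staircase at v that uses the edge
    (v, u).  It has a larger prefix than R, and everything to the left of it
    leaves v below that edge. *)
Lemma departs_low_middle T : T \in S -> visits T v -> pre v T = pre v R ->
  low v u R T -> exists Z, [/\ Z \in S, visits Z v, agrees v u R Z, pre v R < pre v Z
    & forall Y, Y \in S -> visits Y v -> pre v Y < pre v Z -> suf v Y <= suf v R].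
Proof.
move=> TS tT eT /andP[ngT ltT].
have [Z0 [Z0S tZ0 gZ0]] := departs_middle.
have [|Z /and3P[ZS tZ gZ] Zmin] := @ex_argmin _
  [pred Y | [&& Y \in S, visits Y v & agrees v u R Y]] (level v).
  by exists Z0; rewrite /= Z0S tZ0.
exists Z; split=> //.
  have [/(_ ltT) bTZ _] := middle_lt tT gZ ngT.
  have := family_chain cS TS ZS tT tZ.
  suff : pre v Z <> pre v R by ord.
  by move=> e; have := departs_fork ZS tZ e; rewrite gZ.
move=> Y YS tY aYZ; rewrite leqNgt; apply/negP => bRY.
have ch := family_chain cS YS ZS tY tZ.
case gY: (agrees v u R Y).
  by have := Zmin Y; rewrite /= YS tY gY /level => /(_ isT); ord.
by have [_ /(_ bRY)] := middle_lt tY gZ (negbT gY); ord.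
Qed.

Hypothesis satS : saturated S.

(** After the last point with the prefix of R the staircase moves to the right
    without rising: R is to the upper left of the next point. *)
Lemma departs_low_cw T : T \in S -> visits T v -> pre v T = pre v R ->
  low v u R T -> exists2 B, B \in S & cw v R B.
Proof.
move=> TS tT eT /andP[ngT ltT].
have [Z [ZS tZ gZ]] := departs_middle; have [tR _] := departs_visits.
have [/(_ ltT) bTZ _] := middle_lt tT gZ ngT.
have [|||T1 [B [adjTB /= lT lB l1 l2]]] := @saturated_step _ S v
  [pred Y | pre v Y == pre v R] T Z cS TS ZS tT tZ; rewrite /= ?eT ?eqxx //.
- by apply: contraTN gZ => /eqP; apply: departs_fork.
- by have := family_chain cS TS ZS tT tZ; rewrite /level; ord.
have [[T1S BS tT1 tB] _ [leA leB] _] := adjTB.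
have ngT1 := departs_fork T1S tT1 (eqP lT).
have eB : suf v T1 = suf v B.
  by case: (satS adjTB) => // e; rewrite -e lT in lB.
have ltT1 : suf v T1 < suf v R.
  have neT : suf v T1 <> suf v R.
    move=> e; case/negP: ngT1; case: dep => -[_ tu vu _] _ _.
    exact: suf_agrees (esym e) tR tT1 (ltnW vu) tu.
  have [_ h] := middle_lt tT1 gZ ngT1; move/eqP: lT lB => lT /eqP lB; ord.
exists B => //; rewrite /cw tR tB /=.
move/eqP: lT lB => lT /eqP lB; apply/andP; split; ord.
Qed.

(** From the points that use the edge (v, u) the staircase rises to the point T
    with the prefix of R.  The first point above the edge is reached by a
    vertical step, and as it is to the left of T the staircase turns right before
    T: the turning point is the corner.  The last clause records that no
    point that is not above the edge is higher than P. *)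
Lemma departs_high_corner T : T \in S -> visits T v -> pre v T = pre v R ->
  high v u R T -> exists P Q0 Q, [/\ corner S v P Q0 Q, cw v Q0 R,
    pre v Q <= pre v R &
    forall Y, Y \in S -> visits Y v -> ~~ high v u R Y -> suf v Y <= suf v P].
Proof.
move=> TS tT eT hT; have [tR vu] := departs_visits.
have [Z [ZS tZ gZ]] := departs_middle.
have nhZ : ~~ high v u R Z by rewrite /high gZ.
have [|W /and3P[WS tW hW] Wmin] := @ex_argmin _
  [pred Y | [&& Y \in S, visits Y v & high v u R Y]] (level v).
  by exists T; rewrite /= TS tT.
have [ngW ltW] := andP hW; have [ngT ltT] := andP hT.
have [_ /(_ ltW) bZW] := middle_lt tW gZ ngW.
have chZW := family_chain cS ZS WS tZ tW.
have leWT : level v W <= level v T by apply: Wmin; rewrite /= TS tT.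
have chWT := chain_lt cS WS TS tW tT leWT.
have [|||P0 [W' [adjPW lP lW l1 l2]]] := @saturated_step _ S v
  [pred Y | ~~ high v u R Y] Z W cS ZS WS tZ tW; rewrite /= ?nhZ ?hW //.
  by rewrite /level; ord.
have eW : W' = W.
  case: (adjPW) => -[_ W'S _ tW'] _ _ _; apply: (chain_eq cS W'S WS tW' tW).
  have := Wmin W'; rewrite /= W'S tW' (negbNE lW) => /(_ isT).
  by rewrite /level; ord.
rewrite {}eW in adjPW lW l2.
have [[P0S _ tP0 _] nP0W [leA leB] adjP] := adjPW.
have bP0W : suf v P0 < suf v W.
  rewrite ltn_neqAle leB andbT; apply: contra lP => /eqP e.
  rewrite /high e ltW andbT; apply: contra ngW => g.
  have [_ _ _ _ tP0u] := agrees_visits g; apply: (agrees_trans g).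
  exact: suf_agrees e tP0 tW (ltnW vu) tP0u.
(* W is reached by a vertical step, and it is to the left of R *)
have aP0W : pre v P0 = pre v W by case: (satS adjPW) => // e; rewrite e ltnn in bP0W.
have aWR : pre v W < pre v R.
  rewrite ltn_neqAle; apply/andP; split; last by ord.
  apply/eqP => e; have ngP := departs_fork P0S tP0 (etrans aP0W e).
  move: lP; rewrite /= /high ngP /= -leqNgt leq_eqVlt => /orP[/eqP eb|lt].
    case/negP: ngP; case: dep => -[_ tu _ _] _ _.
    exact: suf_agrees (esym eb) tR tP0 (ltnW vu) tu.
  have [/(_ lt) k _] := middle_lt tP0 gZ ngP.
  by case: (adjP Z ZS tZ); ord.
have [|||R0 [Q [adjRQ lR lQ k1 k2]]] := @saturated_step _ S v
  [pred Y | pre v Y <= pre v W] W T cS WS TS tW tT; rewrite /= ?eT -?ltnNge //.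
have [[R0S QS tR0 tQ] nRQ [leRA leRB] adjQ] := adjRQ.
rewrite /= in lR lQ.
have aR0W : pre v R0 = pre v W by ord.
have bR0Q : suf v R0 = suf v Q by case: (satS adjRQ) => //; ord.
have P0R : level v P0 < level v R0 by rewrite /level; ord.
have [P adjPR lePP] := adjacent_pred cS R0S P0S tR0 tP0 P0R.
have [[PS _ tP _] nPR [lePA lePB] _] := adjPR.
have chP := chain_lt cS P0S PS tP0 tP lePP.
exists P, R0, Q; split.
- by split=> //; ord.
- by rewrite /cw tR tR0 /= aR0W aWR; ord.
- by ord.
move=> Y YS tY nhY; case: (adjP Y YS tY) => [|[kA kB]]; first by ord.
case/negP: nhY; rewrite /high; apply/andP; split; last by ord.
apply: contraTN kB => g; rewrite -ltnNge.
by have [_ /(_ ltW)] := middle_lt tW g ngW.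
Qed.

End Departs.
End Departure.

(** * The framing order *)

Section FramingOrder.
Variable G : route_system.
Implicit Types (P Q R T B X Y Z : sroute G) (u v w x y : svertex G) (S C D : {set sroute G}).

Lemma covering_ex S : covering S -> sroute G -> exists Z, Z \in S.
Proof.
move=> covS R; have nso : source G != sink G.
  by apply: contraTneq (source_lt_sink G) => ->; rewrite ltnn.
have [u uv] := next_vertex (visits_source R) nso.
by have [Z ZS _] := covS _ _ _ uv; exists Z.
Qed.

Lemma family_sub S C : S \subset C -> compatible_family C -> compatible_family S.
Proof. by move=> /subsetP SC cC P Q PS QS; apply: cC; apply: SC. Qed.

(** Without R the family C is no longer maximal although it covers the graph.  If
    it were still saturated, the departure of R would exhibit a route of C
    incoherent with R.  So R fills a step of the smaller family in which both
    coordinates increase. *)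
Lemma corner_of_covering C R : maximal_family C -> R \in C -> covering (C :\ R) ->
  exists v P Q, corner C v P R Q \/ @corner (swap G) C v P R Q.
Proof.
move=> mC RC covS; have [cC _] := mC; have satC := maximal_family_saturated mC.
pose S := C :\ R; have SC : S \subset C := subD1set C R.
have cS : compatible_family S := family_sub SC cC.
have [satS|] := pselect (saturated S).
  exfalso; have [Z ZS] := covering_ex covS R.
  have RS : R \notin S by rewrite !inE eqxx.
  have [v [u dep]] := departure covS ZS RS.
  have [T [TS tT eT [lT|hT]]] := departs_low_high dep.
    have [B BS] := departs_low_cw cS covS dep satS TS tT eT lT.
    by apply/negP; apply: cC => //; apply: (subsetP SC).
  have [P [Q0 [Q [k + _ _]]]] := departs_high_corner cS covS dep satS TS tT eT hT.
  by apply/negP; apply: cC => //; have [_ Q0S _] := corner_mem k; apply: (subsetP SC).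
move=> /existsNP[v] /existsNP[T] /existsNP[B] /not_implyP[adjTB /not_orP[nA nB]].
have [[TS BS tT tB] nTB [leA leB] adjS] := adjTB.
have TC := subsetP SC _ TS; have BC := subsetP SC _ BS.
have nTR : T != R by case/setD1P: TS.
have nBR : B != R by case/setD1P: BS.
have [tR lTR lRB] : [/\ visits R v, level v T <= level v R & level v R <= level v B].
  apply: contra_notP nA => nR.
  have adjC : adjacent C v T B.
    split=> // Y YC tY; case: (eqVneq Y R) => [eY|nY]; last first.
      by apply: adjS; rewrite // !inE nY.
    rewrite {}eY in YC tY *.
    case: (leqP (level v R) (level v T)) => [/(chain_lt cC YC TC tY tT)|h1]; first by left.
    case: (leqP (level v B) (level v R)) => [/(chain_lt cC BC YC tB tY)|h2]; first by right.
    by case: nR; split=> //; apply: ltnW.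
  by case: (satC _ _ _ adjC) => // /nB.
have chTR := chain_lt cC TC RC tT tR lTR; have chRB := chain_lt cC RC BC tR tB lRB.
have adjTR : adjacent C v T R.
  split=> // Y YC tY; case: (eqVneq Y R) => [->|nY]; first by right.
  by case: (adjS Y); rewrite ?inE ?nY //; [left|right; ord].
have adjRB : adjacent C v R B.
  split=> //; first by rewrite eq_sym.
  move=> Y YC tY; case: (eqVneq Y R) => [->|nY]; first by left.
  by case: (adjS Y); rewrite ?inE ?nY //; [left; ord|right].
exists v, T, B; have := satC _ _ _ adjTR; have := satC _ _ _ adjRB.
case=> e1 [] e2; [ord|right|left|ord].
  by split=> //=; apply/adjacent_swap.
by split.
Qed.

(** By induction on the vertex where R leaves the prefixes of D.  If R leaves
    below the routes with its prefix, the corner of [departs_high_corner] is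
    incoherent with R, hence not in S.  If it leaves above them, the prefix of R
    is replaced by that of the first route of D through the next edge; the new
    route is still coherent with S, is still to the lower right of R', and leaves
    D later. *)
Lemma corner_outside D S : maximal_family D -> S \subset D -> forall R R' z,
  {in S, forall Y, compatible R Y} -> R' \in D -> cw z R' R ->
  exists v P Q0 Q, corner D v P Q0 Q /\ Q0 \notin S.
Proof.
move=> mD SD; have [cD _] := mD; have satD := maximal_family_saturated mD.
have covD := maximal_family_covering mD.
suff main n : forall R R' z, {in S, forall Y, compatible R Y} -> R' \in D -> cw z R' R ->
    (exists2 x, shares D R x & visits R x /\ copos x <= n) ->
    exists v P Q0 Q, corner D v P Q0 Q /\ Q0 \notin S.
  move=> R R' z cohR R'D cz.
  apply: (main (copos (source G)) R R' z cohR R'D cz); exists (source G).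
    by exists R'; split; [|exact: visits_source|exact: pre_source].
  by split; [exact: visits_source|exact: leqnn].
elim/ltn_ind: n => n IHn R R' z cohR R'D cz [x shx [tx xn]].
have RD : R \notin D.
  by apply: contraL cz => RD; apply: cD.
have [v [u dep]] := departure covD R'D RD; have [tR vu] := departs_visits dep.
have xv : pos x <= pos v by case: dep => _ _; apply.
have [T [TD tT eT [lT|hT]]] := departs_low_high dep; last first.
  have [P [Q0 [Q [k cQ0 _ _]]]] := departs_high_corner cD covD dep satD TD tT eT hT.
  exists v, P, Q0, Q; split=> //; apply: contraTN cQ0 => Q0S.
  by have [_] := cohR Q0 Q0S; apply.
have [Z [ZD tZ gZ aRZ hZ]] := departs_low_middle cD covD dep TD tT eT lT.
have [tX aX bX] := glueP tZ tR; move: (glue v Z R) tX aX bX => X tX aX bX.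
(* R' and R are not incoherent at v, since T has the prefix of R and is lower *)
have nvR : ~~ cw v R' R.
  apply: not_cw => tR' _ lt; have /(cwP tR' tT) := cD R' T R'D TD v.
  by case/andP: lT; ord.
have un : copos u < n by have := pos_copos x; have := pos_copos u; ord.
apply: (IHn _ un X R' z).
- move=> Y YS; have YD := subsetP SD _ YS; have [nRY nYR] := cohR Y YS.
  apply: (compatible_glue tX tZ tR aX bX); [by split; apply: cD|exact: cohR| |].
    by apply: not_cw => _ tY; have /(cwP tR tY) := nRY v; ord.
  by apply: not_cw => tY _; have := hZ Y YD tY; ord.
- exact: R'D.
- case: (leqP (pos z) (pos v)) => zv.
    have [_ /(_ cz)] := cw_before R' zv tR tT (esym eT).
    case=> [|[_]]; last by apply: contraTT.
    by apply: contraTT => _; apply: cD.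
  have [_ /(_ cz)] := cw_after R' (ltnW zv) tR tX (esym bX).
  by case=> [//|[_]]; apply: contraTT.
exists u; last first.
  have [_ _ _ _ tZu] := agrees_visits gZ; have [_ _ tRu _ _] := agrees_visits gZ.
  have h := suf_agrees (esym bX) tR tX (ltnW vu) tRu.
  by have [_ _ _ _ tXu] := agrees_visits h.
have [_ _ tRu _ tZu] := agrees_visits gZ.
have h := agrees_trans (agrees_sym (suf_agrees (esym bX) tR tX (ltnW vu) tRu)) gZ.
by exists Z; split=> //; apply/esym/(proj1 (agrees_eq_pre h)).
Qed.

Lemma below_antisym C D : maximal_family C -> maximal_family D -> below C D -> below D C -> C = D.
Proof.
move=> [cC mC] [cD mD] CD DC; apply/eqP; rewrite eqEsubset; apply/andP.
by split; apply/subsetP => X XC; [apply: mD|apply: mC] => Y YD; split;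
  first [exact: CD|exact: DC].
Qed.

Lemma below_refl C : compatible_family C -> below C C.
Proof. by move=> cC P Q PC QC; apply: cC. Qed.

(** Among the routes of D outside C, take R leaving the prefixes of C as early as
    possible, and flip the corner of [departs_high_corner].  A route Y of D
    obstructing this flip lies in the rectangle spanned by P and Q.  Coherence
    with R forces it through the edge (v, u), and the choice of R forces the
    prefix of Y at v to be that of P.  So Y leaves C after u, again below some
    route T' with its prefix; at v this T' is higher than P, although P is the
    highest point of C that uses the edge or passes below it. *)
Lemma below_step C D : maximal_family C -> maximal_family D -> below C D -> C != D ->
  exists v P Q0 Q, corner C v P Q0 Q /\ below (flip v P Q0 Q C) D.
Proof.
move=> mC mD CD nCD; have [cC _] := mC; have [cD _] := mD.
have satC := maximal_family_saturated mC; have covC := maximal_family_covering mC.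
have depart R : R \in D -> R \notin C -> exists v u, departs C R v u.
  move=> RD; have [Y YC] := maximal_family_neq0 mC R; exact: departure covC YC.
have fork R v u : R \in D -> departs C R v u ->
    exists T, [/\ T \in C, visits T v, pre v T = pre v R & high v u R T].
  move=> RD dep; have [T [TC tT eT [lT|hT]]] := departs_low_high dep.
    have [B BC] := departs_low_cw cC covC dep satC TC tT eT lT.
    by rewrite (negPf (CD B R BC RD v)).
  by exists T.
have [R0 /andP[R0D R0C]] : exists R, (R \in D) && (R \notin C).
  case: (boolP [exists R in D, R \notin C]) => [/exists_inP[R RD RC]|nR].
    by exists R; rewrite RD.
  case/eqP: nCD; apply: below_antisym => // P Q PD QC v; apply: cC => //.
  by apply: contraR nR => PC; apply/exists_inP; exists P.
have [v0 [u0 dep0]] := depart R0 R0D R0C.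
have [|[R v] /and3P[/= RD RC /asboolP[u dep]] vmin] := @ex_argmin _
  [pred Rv : sroute G * svertex G | [&& Rv.1 \in D, Rv.1 \notin C &
     `[< exists u, departs C Rv.1 Rv.2 u >]]] (fun Rv => pos Rv.2).
  by exists (R0, v0); rewrite /= R0D R0C; apply/asboolP; exists u0.
have [T [TC tT eT hT]] := fork R v u RD dep; have [tR vu] := departs_visits dep.
have [P [Q0 [Q [k cQ0 aQR hP]]]] := departs_high_corner cC covC dep satC TC tT eT hT.
exists v, P, Q0, Q; split=> // X Y /setU1P[->|/setD1P[_ XC]] YD; last exact: CD.
have [PC Q0C QC] := corner_mem k; have [tP tQ0 tQ] := corner_visits k.
have [bPQ0 aQ0Q ePQ0 eQ0Q] := corner_lt k.
have [_ {}PC] := setD1P PC; have [_ {}QC] := setD1P QC.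
have [tX aX bX] := glueP tQ tP.
have [_ ncw] := ncw_glue Y tX tQ tP aX bX.
apply: ncw; [exact: CD|exact: CD|apply/negP => cY].
have [tY _ aYX bXY] := and4P cY; rewrite aX in aYX; rewrite bX in bXY.
have bYR : suf v Y <= suf v R.
  by have /(cwP tY tR) := cD Y R YD RD v; ord.
have aPY : pre v P <= pre v Y.
  by have /(cwP tY tP) := CD P Y PC YD v; ord.
have [Z [ZC tZ gZ]] := departs_middle covC dep.
have bZP : suf v Z <= suf v P by apply: hP => //; rewrite /high gZ.
(* P and Y use the edge (v, u): Z does, and suffixes are compared
   lexicographically *)
have gP : agrees v u R P.
  apply/negPn/negP => ng; have [h _] := middle_lt tP gZ ng; ord.
have [_ _ tRu _ tPu] := agrees_visits gP.
have gY : agrees v u R Y.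
  apply/negPn/negP => ng; have [h _] := middle_lt tY gP ng.
  case: (ltngtP (suf v Y) (suf v R)) => [||e]; [ord|ord|].
  by case/negP: ng; apply: suf_agrees (esym e) tR tY (ltnW vu) tRu.
have YC : Y \notin C.
  apply/negP => YC; have := hP Y YC tY; rewrite /high gY => /(_ isT); ord.
have [v' [u' dep']] := depart Y YD YC.
have vv' : pos v <= pos v'.
  by apply: (vmin (Y, v')); rewrite /= YD YC; apply/asboolP; exists u'.
have [T' [T'C tT' eT' hT']] := fork Y v' u' YD dep'.
have g' := pre_agrees (esym eT') (proj1 (departs_visits dep')) tT' vv' tY.
have [_ _ _ tT'v _] := agrees_visits g'.
have bYT' : suf v Y < suf v T' by rewrite (agrees_suf g'); case/andP: hT'.
have aYT' : pre v Y = pre v T' := proj2 (agrees_eq_pre g') (esym eT').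
(* the prefix of Y at v occurs in C, and P and Q0 are the only candidates *)
have aYP : pre v Y = pre v P.
  by case: (corner_between k T'C tT'v) => [|e|]; [ord|rewrite e in aYT'; ord|ord].
have gPY := agrees_trans (agrees_sym gP) gY.
have uv' : pos u <= pos v'.
  case: dep' => _ _; apply; first by case: (agrees_visits gY).
  exists P; split=> //; exact: (proj1 (agrees_eq_pre gPY)) (esym aYP).
have [_ _ _ _ tYu] := agrees_visits gY.
have [gYT' _] := agrees_sub g' tYu (ltnW vu) uv'.
have := hP T' T'C tT'v; rewrite /high (agrees_trans gY gYT') => /(_ isT); ord.
Qed.

(** Let R be weakly to the lower right of the corner Q0 at v, and not to the upper
    left of the opposite corner X at u.  Then R is still weakly to the lower
    right of one of the neighbours P and Q, which passes through v.  Indeed Q0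
    agrees with P before u and with Q after u.  If R is squeezed at v between Q0
    and the neighbour that passes through v for this reason, it follows both as
    far as u; there the excluded rectangle puts it beyond the other neighbour,
    which therefore follows Q0 back to v. *)
Lemma flip_factor C v u P Q0 Q X R : corner C u P Q0 Q ->
  visits X u -> pre u X = pre u Q -> suf u X = suf u P -> ~~ cw u R X ->
  visits Q0 v -> visits R v -> pre v Q0 <= pre v R -> suf v R <= suf v Q0 ->
  [/\ visits P v, pre v P = pre v Q0, suf v P < suf v Q0 & suf v R <= suf v P] \/
  [/\ visits Q v, pre v Q0 < pre v Q, pre v Q <= pre v R & suf v R <= suf v Q].
Proof.
move=> k tX aX bX nX tQ0v tRv aQ0R bRQ0.
have [tP tQ0 tQ] := corner_visits k; have [bPQ0 aQ0Q ePQ0 eQ0Q] := corner_lt k.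
have nX' : visits R u -> pre u R < pre u Q -> suf u R <= suf u P.
  by move=> tR; rewrite -aX -bX; apply/cwP.
case: (leqP (pos v) (pos u)) => vu.
  have gP := pre_agrees (esym ePQ0) tQ0 tP vu tQ0v; have [_ _ _ tPv _] := agrees_visits gP.
  have aP := proj2 (agrees_eq_pre gP) (esym ePQ0).
  have bP : suf v P < suf v Q0 by rewrite (agrees_suf (agrees_sym gP)).
  case: (leqP (suf v R) (suf v P)) => bRP; first by left.
  have [/(_ bRP) [g|lt] _] := suf_diverge (agrees_sym gP) tRv; last by exfalso; ord.
  have [_ _ _ _ tRu] := agrees_visits g; have gR := agrees_trans gP g.
  have bPR : suf u P < suf u R by rewrite -(agrees_suf g).
  have aQR : pre u Q <= pre u R by have := nX' tRu; ord.
  have [/(_ aQ0Q) [gQ|lt] _] := pre_diverge gR tQ; last by exfalso; ord.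
  have [_ _ _ tQv _] := agrees_visits gQ; right; split=> //.
  - by rewrite (agrees_pre gQ).
  - by rewrite leqNgt (agrees_pre (agrees_trans (agrees_sym gR) gQ)) -leqNgt.
  - by rewrite -(proj2 (agrees_eq_suf gQ) eQ0Q).
have gQ := suf_agrees eQ0Q tQ0 tQ (ltnW vu) tQ0v; have [_ _ _ _ tQv] := agrees_visits gQ.
have bQ := proj1 (agrees_eq_suf gQ) eQ0Q.
have aQ : pre v Q0 < pre v Q by rewrite -(agrees_pre gQ).
case: (leqP (pre v Q) (pre v R)) => aRQ; first by right; split=> //; rewrite -bQ.
have [_ /(_ aRQ) [g|]] := pre_diverge (agrees_sym gQ) tRv; last by move=> ?; exfalso; ord.
have [_ _ _ tRu _] := agrees_visits g; have gR := agrees_trans gQ g.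
have aRQu : pre u R < pre u Q by rewrite (agrees_pre (agrees_sym g)).
have bRP := nX' tRu aRQu.
have [_ /(_ bPQ0) [gP|]] := suf_diverge gR tP; last by move=> ?; exfalso; ord.
have [_ _ _ _ tPv] := agrees_visits gP; left; split=> //.
- exact: esym (proj1 (agrees_eq_pre gP) (esym ePQ0)).
- by rewrite -(agrees_suf (agrees_sym gP)).
- by rewrite leqNgt -(agrees_suf (agrees_trans (agrees_sym gP) gR)) -leqNgt.
Qed.

(** Along the common part of R and R', follow the vertices where C has points to
    the right of R'.  At the start C covers the edge of R, at the end it covers
    the edge of R.  If no point of C were weakly to the upper left of R', a
    staircase with points on both sides of R' would have a step increasing both
    coordinates; so all points would stay to the right of R' along the whole
    common part, which fails at its end. *)
Lemma cw_witness C R R' z : maximal_family C -> {in C, forall Y, ncw R' Y} -> cw z R' R ->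
  exists v X, [/\ X \in C, visits X v, cw v R' R, pre v X <= pre v R' & suf v R' <= suf v X].
Proof.
move=> mC hR' cz; have [cC _] := mC; have covC := maximal_family_covering mC.
have [tR' tR ltA ltB] := and4P cz.
have cwag x y : agrees x y R' R -> cw x R' R = cw y R' R.
  by move=> g; have [_ t1 t2 t3 t4] := agrees_visits g;
    rewrite /cw t1 t2 t3 t4 (agrees_pre g) (agrees_suf (agrees_sym g)).
have [w [g _ [Y0 Y0C [tY0 aY0]]]] := split_in_cover covC tR' tR ltA.
have [|v /andP[cv /exists_inP[Y YC /andP[tY aY]]] vmax] := @ex_argmax _
  [pred v | cw v R' R && [exists Y in C, visits Y v && (pre v R' < pre v Y)]] (@pos G).
  exists w; rewrite /= (cwag _ _ g) cz; apply/exists_inP; exists Y0 => //.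
  by rewrite tY0.
exists v; apply: contrapT => nH.
have [tR'v tRv aR'R bRR'] := and4P cv.
have hY W : W \in C -> visits W v -> pre v R' < pre v W -> suf v R' <= suf v W.
  by move=> WC tW; apply/(cwP tR'v tW)/hR'.
have notH W : W \in C -> visits W v -> suf v R' <= suf v W -> pre v R' < pre v W.
  move=> WC tW h; rewrite ltnNge; apply/negP => h'; apply: nH; exists W; split=> //.
(* otherwise a step of the staircase from W to Y would pass from the points
   below R' to those to its right *)
have noL W : W \in C -> visits W v -> suf v R' <= suf v W.
  move=> WC tW; rewrite leqNgt; apply/negP => lt.
  have bY := hY Y YC tY aY.
  have [|||T [B [adjTB /= lT lB _ _]]] := @saturated_step _ C v
    [pred X | suf v X < suf v R'] W Y cC WC YC tW tY; rewrite /= -?leqNgt //.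
    by have := family_chain cC WC YC tW tY; rewrite /level; ord.
  have [[TC BC tT tB] _ _ _] := adjTB.
  have := hY T TC tT; have := notH B BC tB; have := maximal_family_saturated mC adjTB.
  by ord.
have [w' [g' [W WC [tW bW]] _]] := split_out_cover covC tRv tR'v bRR'.
have [vw' _ tRw' _ tR'w'] := agrees_visits g'.
have nvw' : v != w'.
  by apply: contraTneq bW => e; rewrite -leqNgt -e noL // e.
have nv : v != sink G.
  apply: contraNneq nvw' => e; rewrite e in vw' *; apply/eqP/pos_inj.
  by apply/eqP; rewrite eqn_leq vw' pos_sink.
have [u vu] := next_vertex tR'v nv; have [_ tR'u ltvu nx] := vu.
have uw' : pos u <= pos w'.
  case: (nx _ tR'w') => // h; case/eqP: nvw'; apply: (@pos_inj G).
  by apply/eqP; rewrite eqn_leq vw' h.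
have [gu _] := agrees_sub (agrees_sym g') tR'u (ltnW ltvu) uw'.
have [Z ZC gZ] := covC _ _ _ vu; have [_ _ _ tZ tZu] := agrees_visits gZ.
have := vmax u; rewrite /= -(cwag _ _ gu) cv /= => /(_ _)/(leq_trans ltvu).
rewrite ltnn => h; suff : false by []; apply: h.
apply/exists_inP; exists Z; rewrite // tZu -(agrees_pre gZ) notH //; exact: noL.
Qed.

(** Suppose R' of D is to the upper left of R, and take a point x of C weakly to
    the upper left of R' and as far to the lower right as possible.  It is
    incoherent with R, so it is not in S and it is a corner with flip below D.
    By [flip_factor] one of its neighbours is a better choice. *)
Lemma flips_below C D S : maximal_family C -> S \subset C -> below C D ->
  {in C :\: S, forall R, exists v P Q, corner C v P R Q /\
     {in D, forall R', ~~ cw v R' (glue v Q P)}} ->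
  forall R R', {in S, forall Y, ncw Y R} -> R' \in D -> ncw R' R.
Proof.
move=> mC SC CD hS R R' hR R'D z; apply/negP => cz.
have [|v [x0 [x0C tx0 cv ax0 bx0]]] := cw_witness mC _ cz.
  by move=> Y YC; apply: CD.
pose H := [pred X | [&& X \in C, visits X v, pre v X <= pre v R' & suf v R' <= suf v X]].
have Hx0 : H x0 by rewrite /= x0C tx0 ax0.
have [|x1 Hx1 x1max] := @ex_argmax _ H (pre v); first by exists x0.
have [|x /andP[/and4P[xC tx ax bx] ax1] xmin] := @ex_argmin _
  [pred X | H X && (pre v x1 <= pre v X)] (suf v).
  by exists x1; rewrite /= in Hx1 *; rewrite Hx1 leqnn.
have [tR' tR aR'R bRR'] := and4P cv.
have xS : x \notin S.
  apply/negP => /hR/(_ v); apply/negP; rewrite negbK /cw tx tR.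
  by apply/and4P; split=> //; ord.
have [|u [P [Q [k kD]]]] := hS x; first by rewrite inE xS.
have [tP _ tQ] := corner_visits k; have [tX aX bX] := glueP tQ tP.
have [PC _ QC] := corner_mem k.
case: (flip_factor k tX aX bX (kD R' R'D) tx tR' ax bx) => -[t h1 h2 h3].
  have := xmin P; rewrite /= t h1 ax h3 ax1; case/setD1P: PC => _ -> /(_ isT); ord.
have := x1max Q; rewrite /= t h2 h3; case/setD1P: QC => _ -> /(_ isT); ord.
Qed.

End FramingOrder.

(** * Stars *)

Section Supersets.
Variable G : route_system.
Implicit Types (P Q R T B X Y Z : sroute G) (u v w x y : svertex G) (S C D E : {set sroute G}).

Lemma ncw_refl P : ncw P P.
Proof. by move=> v; rewrite /cw ltnn !andbF. Qed.

Lemma maximal_extension S : compatible_family S -> exists2 C, maximal_family C & S \subset C.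
Proof.
move=> cS; have [|C /andP[/asboolP cC SC] Cmax] := @ex_argmax _
  [pred C : {set sroute G} | `[< compatible_family C >] && (S \subset C)] (fun C => #|C|).
  by exists S; rewrite /= subxx andbT; apply/asboolP.
exists C => //; split=> // X hX.
have cX : compatible_family (X |: C).
  move=> P Q /setU1P[->|PC] /setU1P[->|QC]; first exact: ncw_refl.
  - by case: (hX Q QC).
  - by case: (hX P PC).
  - exact: cC.
have := Cmax (X |: C); rewrite /= (subset_trans SC (subsetUr _ _)) andbT.
move=> /(_ (asboolT cX)); rewrite cardsU1; case: (X \in C) => //=.
by rewrite add1n ltnn.
Qed.

Lemma flip_superset v P R Q S C : corner C v P R Q -> S \subset C -> R \notin S ->
  S \subset flip v P R Q C /\ R \notin flip v P R Q C.
Proof.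
move=> k /subsetP SC RS; have [bPR aRQ ePR eRQ] := corner_lt k.
have [tP tR tQ] := corner_visits k; have [tX aX bX] := glueP tQ tP.
split; last first.
  rewrite !inE eqxx /= orbF; apply/eqP => e; rewrite -e in aX bX; ord.
apply/subsetP => Y YS; apply: setU1r; rewrite !inE (SC Y YS) andbT.
by apply: contraNneq RS => <-.
Qed.

End Supersets.

Section Extremes.
Variable G : route_system.
Implicit Types (P Q R T B X Y Z : sroute G) (u v w x y : svertex G) (S C D E : {set sroute G}).

(** Take D maximal for [below] in the star.  If some other member C were not
    below D, there would be a corner of D outside S, and its flip would be a
    larger member. *)
Lemma star_greatest S : compatible_family S -> exists D, [/\ maximal_family D, S \subset D &
  forall C, maximal_family C -> S \subset C -> below C D].
Proof.
move=> cS; have [C0 mC0 SC0] := maximal_extension cS.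
pose f D := #|[set C | `[< maximal_family C /\ below C D >]]|.
have [|D /andP[/asboolP mD SD] Dmax] := @ex_argmax _
  [pred C : {set sroute G} | `[< maximal_family C >] && (S \subset C)] f.
  by exists C0; rewrite /= SC0 andbT; apply/asboolP.
exists D; split=> // C mC SC R R' RC R'D z; apply/negP => cz; have [cC _] := mC.
have [|v [P [Q0 [Q [k Q0S]]]]] := corner_outside mD SD _ R'D cz.
  by move=> Y /(subsetP SC) YC; split; apply: cC.
have [mD1 _ _ DD1 _] := flipP mD k; have [SD1 Q0D1] := flip_superset k SD Q0S.
have [_ Q0D _] := corner_mem k.
have D1D : below (flip v P Q0 Q D) D.
  suff /setP/(_ (flip v P Q0 Q D)) : [set C | `[< maximal_family C /\ below C D >]] =
      [set C | `[< maximal_family C /\ below C (flip v P Q0 Q D) >]].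
    rewrite !inE; have -> : `[< maximal_family (flip v P Q0 Q D) /\
      below (flip v P Q0 Q D) (flip v P Q0 Q D) >].
      by apply/asboolP; split=> //; apply: below_refl; case: mD1.
    by move/asboolP => -[].
  apply/eqP; rewrite eqEcard; apply/andP; split.
    apply/subsetP => B; rewrite !inE => /asboolP[mB BD]; apply/asboolP.
    by split=> //; apply: (below_trans mB mD mD1).
  by apply: Dmax; rewrite /= SD1 andbT; apply/asboolP.
by move: Q0D1; rewrite -(below_antisym mD mD1 DD1 D1D) Q0D.
Qed.

(** A route of S is coherent with E because it belongs both to a family below E
    and to a family above E. *)
Lemma star_sandwich S C D E : maximal_family E -> S \subset C -> S \subset D ->
  below C E -> below E D -> S \subset E.
Proof.
move=> [_ mE] SC SD CE ED; apply/subsetP => X XS; apply: mE => Y YE.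
by split; [apply: ED; rewrite ?(subsetP SD)|apply: CE; rewrite ?(subsetP SC)].
Qed.

(** A route of S' outside S belongs to some maximal family containing S; removing
    it leaves a covering family, so it is a corner and can be flipped away. *)
Lemma star_sub S S' : compatible_family S -> covering S ->
  (forall C, maximal_family C -> S \subset C -> S' \subset C) -> S' \subset S.
Proof.
move=> cS covS hS; have [C mC SC] := maximal_extension cS.
apply/subsetP => X XS'; apply: contraT => XS.
have XC : X \in C by apply: (subsetP (hS C mC SC)).
have covX : covering (C :\ X).
  move=> R u v /covS[Z ZS g]; exists Z => //; rewrite !inE (subsetP SC) // andbT.
  by apply: contraNneq XS => <-.
have [v [P [Q [k|k]]]] := corner_of_covering mC XC covX.
  have [SC1 XC1] := flip_superset k SC XS; have [mC1 _ _ _ _] := flipP mC k.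
  by rewrite (subsetP (hS _ mC1 SC1)) in XC1.
have mC' : @maximal_family (swap G) C by apply/maximal_family_swap.
have [SC1 XC1] := @flip_superset (swap G) v P X Q S C k SC XS.
have [/maximal_family_swap mC1 _ _ _ _] := @flipP (swap G) C v P X Q mC' k.
by have := subsetP (hS _ mC1 SC1) X XS'; move: XC1 => /= /negP.
Qed.

(** A route outside S can be flipped, and flipping it downwards would contradict
    minimality. *)
Lemma least_corners S C : covering S -> maximal_family C -> S \subset C ->
  (forall D, maximal_family D -> S \subset D -> below C D) ->
  {in C :\: S, forall R, exists v P Q, corner C v P R Q}.
Proof.
move=> covS mC SC least R /setDP[RC RS].
have covR : covering (C :\ R).
  move=> X u v /covS[Z ZS g]; exists Z => //; rewrite !inE (subsetP SC) // andbT.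
  by apply: contraNneq RS => <-.
have [v [P [Q [k|k]]]] := corner_of_covering mC RC covR; first by exists v, P, Q.
exfalso; have mC' : @maximal_family (swap G) C by apply/maximal_family_swap.
have [SC1 RC1] := @flip_superset (swap G) v P R Q S C k SC RS.
have [/maximal_family_swap mC1 _ _ /below_swap C1C _] := @flipP (swap G) C v P R Q mC' k.
by move: RC1; rewrite -(below_antisym mC mC1 (least _ mC1 SC1) C1C) RC.
Qed.

(** Otherwise the dual of [corner_outside] yields a lower right corner of C
    outside S, which would be a corner of both kinds. *)
Lemma corners_least S C : maximal_family C -> S \subset C ->
  {in C :\: S, forall R, exists v P Q, corner C v P R Q} ->
  forall D, maximal_family D -> S \subset D -> below C D.
Proof.
move=> mC SC hcor D mD SD R R' RC R'D z; apply/negP; rewrite -cw_swap => cz.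
have mC' : @maximal_family (swap G) C by apply/maximal_family_swap.
have [|v [P [Q0 [Q [k Q0S]]]]] := @corner_outside (swap G) C S mC' SC R' R z _ RC cz.
  by move=> Y /(subsetP SD) YD; apply/compatible_swap; case: mD => cD _; split; apply: cD.
have [_ Q0C _] := @corner_mem (swap G) C v P Q0 Q k.
have [|u [P' [Q' k']]] := hcor Q0; first by rewrite inE Q0S.
exact: corner_not_both k' k.
Qed.

Lemma rotation_flip C D R X z : maximal_family C -> maximal_family D -> R \in C ->
  D = X |: C :\ R -> cw z R X ->
  exists v P Q, corner C v P R Q /\ D = flip v P R Q C.
Proof.
move=> mC mD RC eD cz; rewrite eD in mD *.
have [v [P [Q k]]] := rotation_corner mC RC mD cz.
exists v, P, Q; split=> //; have [_ _ _ _ uniq] := flipP mC k.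
have [cD maxD] := mD; have [cC _] := mC.
have nXR : X != R by apply: contraTneq cz => ->; rewrite ncw_refl.
have XC : X \notin C.
  apply/negP => XC; suff : R \in X |: C :\ R.
    by rewrite !inE eqxx orbF eq_sym (negPf nXR).
  by apply: maxD => Y /setU1P[->|/setD1P[_ YC]]; split; apply: cC.
have /setU1P[e|] : X \in glue v Q P |: C.
  by apply: uniq => Y YS; split; apply: cD; rewrite ?setU11 // setU1r.
  by rewrite /flip -e.
by rewrite (negPf XC).
Qed.

End Extremes.

(** * The route system of a framed graph *)

Section Lexicographic.
Variables (E : eqType) (r : rel E).
Hypotheses (r_irr : irreflexive r) (r_trans : transitive r)
  (r_total : forall e f, e != f -> r e f || r f e).
Implicit Types (s t p q : seq E).

(** The empty sequence comes first, so that the order is total. *)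
Fixpoint lexlt s t : bool :=
  match s, t with
  | _, [::] => false
  | [::], _ :: _ => true
  | e :: s', f :: t' => r e f || (e == f) && lexlt s' t'
  end.

Lemma lexlt_irr : irreflexive lexlt.
Proof. by elim=> //= e s ->; rewrite r_irr andbF. Qed.

Lemma lexlt_trans : transitive lexlt.
Proof.
move=> t s q; elim: t s q => [|f t IH] [|e s] [|g q] //=.
case/orP=> [ef|/andP[/eqP-> st]]; case/orP=> [fg|/andP[/eqP<- tq]].
- by rewrite (r_trans ef fg).
- by rewrite ef.
- by rewrite fg.
- by rewrite eqxx (IH _ _ st tq) orbT.
Qed.

Lemma lexlt_total s t : s != t -> lexlt s t || lexlt t s.
Proof.
elim: s t => [|e s IH] [|f t] //=; rewrite eqseq_cons.
case: (eqVneq e f) => [-> /= /IH/orP[->|->]|ef _]; rewrite ?orbT //.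
by case/orP: (r_total ef) => ->; rewrite ?orbT.
Qed.

Lemma lexlt_cat2l p s t : lexlt (p ++ s) (p ++ t) = lexlt s t.
Proof. by elim: p => //= e p ->; rewrite r_irr eqxx. Qed.

(** A comparison with [p ++ s] is decided inside p, unless the other side begins
    with p. *)
Lemma lexlt_div p s s' t :
  (lexlt (p ++ s) t -> prefix p t \/ lexlt (p ++ s') t) /\
  (lexlt t (p ++ s) -> prefix p t \/ lexlt t (p ++ s')).
Proof.
elim: p t => [|e p IH] t; first by split=> _; left; exact: prefix0s.
case: t => [|f t] /=; first by split=> //; right.
have [h1 h2] := IH t; rewrite [f == e]eq_sym; split.
  case/orP=> [->|/andP[-> /h1[->|->]]]; by [right|left|right; rewrite orbT].
case/orP=> [->|/andP[-> /h2[->|->]]]; by [right|left|right; rewrite orbT].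
Qed.

Section Rank.
Variables (T : finType) (k : T -> seq E).

Definition rank (P : T) : nat := #|[set Z | lexlt (k Z) (k P)]|.

Lemma rank_lt P Q : (rank P < rank Q) = lexlt (k P) (k Q).
Proof.
have mono X Y : lexlt (k X) (k Y) -> rank X < rank Y.
  move=> lt; apply: proper_card; apply/properP; split.
    by apply/subsetP => Z; rewrite !inE => h; apply: lexlt_trans lt.
  by exists X; rewrite inE ?lexlt_irr.
apply/idP/idP => [|/mono//]; apply: contraTT => nlt.
rewrite -leqNgt; case: (eqVneq (k P) (k Q)) => [e|]; first by rewrite /rank e.
by move/lexlt_total; rewrite (negPf nlt) => /mono/ltnW.
Qed.

Lemma rank_eq P Q : rank P = rank Q <-> k P = k Q.
Proof.
split=> [e|e]; last by rewrite /rank e.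
apply/eqP; apply: contraT => /lexlt_total.
by rewrite -!rank_lt e ltnn.
Qed.

End Rank.
End Lexicographic.

Section Routes.
Variable G : flow_graph.
Implicit Types (P Q : route G) (u v w : vertex G) (p q s : seq (edge G)).

Fixpoint walk u p v : bool :=
  if p is e :: p' then (src e == u) && walk (tgt e) p' v else u == v.

Lemma is_routeE p : is_route p = walk ord0 p ord_max.
Proof.
have h e p' v : path (fun e f => tgt e == src f) e p' && (tgt (last e p') == v)
    = walk (tgt e) p' v.
  by elim: p' e => //= f p' IH e; rewrite -andbA IH eq_sym.
by case: p => //= e p; rewrite h.
Qed.

Lemma walk_cat u p v q w : walk u p v -> walk v q w -> walk u (p ++ q) w.
Proof. by elim: p u => [|e p IH] u /= => [/eqP->//|/andP[-> /IH h /h]]. Qed.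

Lemma walk_split u p q w : walk u (p ++ q) w ->
  exists2 v, walk u p v & walk v q w.
Proof.
elim: p u => [|e p IH] u /=; first by exists u.
by case/andP=> eu /IH[v pv vq]; exists v; rewrite ?eu.
Qed.

Lemma walk_bounds u p v : walk u p v ->
  [/\ u <= v, size p + u <= v & forall e, e \in p -> u <= src e /\ tgt e <= v].
Proof.
elim: p u => [|e p IH] u /=; first by move/eqP->.
case/andP=> /eqP<- /IH[h1 h2 h3]; have lt := src_lt_tgt e; split; [lia|lia|].
by move=> f; rewrite inE => /predU1P[->|/h3]; lia.
Qed.

Lemma walk_start u u' p v : walk u p v -> walk u' p v -> u = u'.
Proof. by case: p => [/eqP-> /eqP->//|e p /andP[/eqP<- _] /andP[/eqP<- _]]. Qed.

Lemma walk_end u p v v' : walk u p v -> walk u p v' -> v = v'.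
Proof. by elim: p u => [u /eqP-> /eqP//|e p IH u /andP[_ h1] /andP[_]]; apply: IH. Qed.

Lemma walk_visit u p v w : walk u p v -> w \in u :: [seq tgt e | e <- p] ->
  exists p1 p2, [/\ p = p1 ++ p2, walk u p1 w & walk w p2 v].
Proof.
elim: p u => [|e p IH] u /=.
  by rewrite inE => uv /eqP->; exists [::], [::]; rewrite /= eqxx.
case/andP=> eu pv; rewrite inE => /predU1P[->|].
  by exists [::], (e :: p); rewrite /= eu eqxx pv.
by move/(IH _ pv) => [p1 [p2 [-> h1 h2]]]; exists (e :: p1), p2; rewrite /= eu.
Qed.

Lemma walk_end_mem u p v : walk u p v -> v \in u :: [seq tgt e | e <- p].
Proof.
elim: p u => [|e p IH] u /=; first by move/eqP->; rewrite inE.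
by case/andP=> _ /IH h; rewrite inE h orbT.
Qed.

Definition prefix_at P v : seq (edge G) := [seq e <- P | tgt e <= v].
Definition suffix_at P v : seq (edge G) := [seq e <- P | v <= src e].

Lemma route_walk P : walk ord0 P ord_max.
Proof. by rewrite -is_routeE; case: P. Qed.

(** Vertices increase along a route, so the filters that define prefixes,
    segments and suffixes recover the pieces of any factorization. *)
Lemma cut3 P u v p s q : P = p ++ s ++ q :> seq _ ->
  walk ord0 p u -> walk u s v -> walk v q ord_max ->
  [/\ [/\ u <= v, u \in vertices P & v \in vertices P], segment P u v = s,
      prefix_at P u = p /\ prefix_at P v = p ++ s &
      suffix_at P u = s ++ q /\ suffix_at P v = q].
Proof.
move=> eP wp ws wq; have [_ _ bp] := walk_bounds wp.
have [uv _ bs] := walk_bounds ws; have [_ _ bq] := walk_bounds wq.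
have keep (f : pred (edge G)) t : {in t, forall e, f e} -> filter f t = t.
  by move=> h; apply/all_filterP/allP.
have drop (f : pred (edge G)) t : {in t, forall e, ~~ f e} -> filter f t = [::].
  move=> h; apply/eqP; rewrite -(negbK (_ == _)) -has_filter.
  by apply/hasPn.
have all3 (f : pred (edge G)) b1 b2 b3 :
    {in p, forall e, f e = b1} -> {in s, forall e, f e = b2} ->
    {in q, forall e, f e = b3} ->
    [seq e <- P | f e] = (if b1 then p else [::]) ++ (if b2 then s else [::]) ++
      (if b3 then q else [::]).
  have one t b' : {in t, forall e, f e = b'} -> filter f t = if b' then t else [::].
    by move=> h; rewrite (eq_in_filter h); case: b' {h}; rewrite ?filter_predT ?filter_pred0.
  by move=> h1 h2 h3; rewrite eP !filter_cat (one _ _ h1) (one _ _ h2) (one _ _ h3).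
rewrite /segment /prefix_at /suffix_at; split.
- split; rewrite // /vertices eP.
    by rewrite map_cat -cat_cons mem_cat (walk_end_mem wp).
  by rewrite catA map_cat -cat_cons mem_cat (walk_end_mem (walk_cat wp ws)).
- rewrite (all3 _ false true false) /= ?cats0 // => e;
    [move/bp|move/bs|move/bq]; have := src_lt_tgt e; lia.
- split.
    rewrite (all3 _ true false false) /= ?cats0 // => e;
      [move/bp|move/bs|move/bq]; have := src_lt_tgt e; lia.
  rewrite (all3 _ true true false) /= ?cats0 // => e;
    [move/bp|move/bs|move/bq]; have := src_lt_tgt e; lia.
- split.
    rewrite (all3 _ false true true) //= => e;
      [move/bp|move/bs|move/bq]; have := src_lt_tgt e; lia.
  rewrite (all3 _ false false true) //= => e;
    [move/bp|move/bs|move/bq]; have := src_lt_tgt e; lia.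
Qed.

Lemma cut2 P v p q : P = p ++ q :> seq _ -> walk ord0 p v -> walk v q ord_max ->
  [/\ v \in vertices P, prefix_at P v = p & suffix_at P v = q].
Proof.
move=> eP wp wq; have wv : walk v [::] v by rewrite /=.
by have [[_ ? _] _ [? _] [? _]] := cut3 (s := [::]) eP wp wv wq.
Qed.

Lemma cut2_ex P v : v \in vertices P ->
  [/\ P = prefix_at P v ++ suffix_at P v :> seq _, walk ord0 (prefix_at P v) v &
      walk v (suffix_at P v) ord_max].
Proof.
move=> /(walk_visit (route_walk P))[p [q [eP wp wq]]].
by have [_ -> ->] := cut2 eP wp wq.
Qed.

Lemma cut3_ex P u v : u \in vertices P -> v \in vertices P -> u <= v ->
  [/\ P = prefix_at P u ++ segment P u v ++ suffix_at P v :> seq _,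
      walk ord0 (prefix_at P u) u, walk u (segment P u v) v &
      walk v (suffix_at P v) ord_max].
Proof.
move=> tu tv uv; have [eP wp wq] := cut2_ex tv.
have : u \in ord0 :: [seq tgt e | e <- prefix_at P v].
  move: tu; rewrite /vertices eP map_cat -cat_cons mem_cat => /orP[//|].
  case/mapP=> e eq eu; have [_ _ /(_ e eq)] := walk_bounds wq.
  by have := src_lt_tgt e; rewrite -eu; lia.
move/(walk_visit wp) => [p1 [p2 [ep w1 w2]]]; rewrite ep -catA in eP.
by have [_ -> [-> _] _] := cut3 eP w1 w2 wq.
Qed.

Lemma segment_cat P u v : u \in vertices P -> v \in vertices P -> u <= v ->
  prefix_at P v = prefix_at P u ++ segment P u v /\
  suffix_at P u = segment P u v ++ suffix_at P v.
Proof.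
move=> tu tv uv; have [eP w1 w2 w3] := cut3_ex tu tv uv.
by have [_ _ [_ ->] [-> _]] := cut3 eP w1 w2 w3.
Qed.

Lemma segment_split P u w v : u \in vertices P -> w \in vertices P ->
  v \in vertices P -> u <= w -> w <= v ->
  segment P u v = segment P u w ++ segment P w v.
Proof.
move=> tu tw tv uw wv; have [eP w1 w2 _] := cut3_ex tu tw uw.
have [_ _ w3 w4] := cut3_ex tw tv wv; have [_ es] := segment_cat tw tv wv.
rewrite es [segment P u w ++ _]catA in eP.
by have [_ -> _ _] := cut3 eP w1 (walk_cat w2 w3) w4.
Qed.

Lemma route_inj P Q : P = Q :> seq _ -> P = Q.
Proof. by move=> e; apply/val_inj/val_inj. Qed.

Lemma route_ex p : walk ord0 p ord_max -> exists P : route G, P = p :> seq _.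
Proof.
move=> wp; have sp : size p <= (fg_n G).+2.
  by have [_ h _] := walk_bounds wp; rewrite /= in h; lia.
have rp : is_route (Bseq sp) by rewrite is_routeE.
by exists (Route rp).
Qed.

Definition splice v P Q : route G :=
  odflt P [pick R : route G | (R : seq _) == prefix_at P v ++ suffix_at Q v].

Lemma spliceP v P Q : v \in vertices P -> v \in vertices Q ->
  [/\ v \in vertices (splice v P Q), prefix_at (splice v P Q) v = prefix_at P v &
      suffix_at (splice v P Q) v = suffix_at Q v].
Proof.
move=> /cut2_ex[_ wp _] /cut2_ex[_ _ wq].
have [R eR] := route_ex (walk_cat wp wq); rewrite /splice.
case: pickP => [R' /eqP eR'|/(_ R)]; last by rewrite eR eqxx.
exact: cut2 eR' wp wq.
Qed.

Lemma agree_sub u w v P Q : agree P Q u v -> w \in vertices P -> u <= w -> w <= v ->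
  agree P Q u w /\ agree P Q w v.
Proof.
case/and5P=> uv tPu tQu tPv /andP[tQv /eqP eq] tPw uw wv.
have [_ _ w1 _] := cut3_ex tPu tPw uw; have [_ _ w2 _] := cut3_ex tPw tPv wv.
have [eQ v1 v2 v3] := cut3_ex tQu tQv uv.
have es := segment_split tPu tPw tPv uw wv.
rewrite -eq es -catA in eQ.
have [[_ _ tQw] e1 _ _] := cut3 eQ v1 w1 (walk_cat w2 v3).
rewrite catA in eQ.
have [_ e2 _ _] := cut3 eQ (walk_cat v1 w1) w2 v3.
by rewrite /agree uw wv tPu tQu tPw tQw tPv tQv e1 e2 !eqxx.
Qed.

Lemma agree_cat u w v P Q : agree P Q u w -> agree P Q w v -> agree P Q u v.
Proof.
case/and5P=> uw tPu tQu tPw /andP[tQw /eqP e1].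
case/and5P=> wv _ _ tPv /andP[tQv /eqP e2].
have uv := leq_trans uw wv.
by rewrite /agree uv tPu tQu tPv tQv !(segment_split _ _ _ uw wv) // e1 e2 eqxx.
Qed.

End Routes.

Section FlowSystem.
Variables (G : flow_graph) (F : framing G).
Implicit Types (P Q : route G) (u v w : vertex G) (p q s : seq (edge G)).
Implicit Types (e f g : edge G).

(** The orders of the sets [In v] are extended to all edges, by first comparing
    the heads, in order to use the lexicographic order of sequences; only edges
    with the same head are ever compared at the first difference. *)
Definition in_lt e f : bool :=
  (tgt e < tgt f) || [&& tgt e == tgt f, e != f & in_le F (tgt e) e f].
Definition out_lt e f : bool :=
  (src e < src f) || [&& src e == src f, e != f & out_le F (src e) e f].

Lemma in_lt_irr : irreflexive in_lt.
Proof. by move=> e; rewrite /in_lt ltnn !eqxx. Qed.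

Lemma out_lt_irr : irreflexive out_lt.
Proof. by move=> e; rewrite /out_lt ltnn !eqxx. Qed.

Lemma in_lt_trans : transitive in_lt.
Proof.
move=> f e g; rewrite /in_lt.
case/orP=> [h1|/and3P[/eqP h1 n1 l1]]; case/orP=> [h2|/and3P[/eqP h2 n2 l2]].
- by rewrite (ltn_trans h1 h2).
- by rewrite -h2 h1.
- by rewrite h1 h2.
have [_ anti trans _] := in_le_linear F (tgt e).
have [ie jf kg] : [/\ e \in In (tgt e), f \in In (tgt e) & g \in In (tgt e)].
  by rewrite !inE h1 h2 !eqxx.
rewrite -h1 in l2 h2; rewrite -h2 eqxx (trans f e g) //= andbT.
apply/orP; right; apply: contra n1 => /eqP eg; rewrite -eg in l2.
by apply/eqP/anti; rewrite ?l1.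
Qed.

Lemma out_lt_trans : transitive out_lt.
Proof.
move=> f e g; rewrite /out_lt.
case/orP=> [h1|/and3P[/eqP h1 n1 l1]]; case/orP=> [h2|/and3P[/eqP h2 n2 l2]].
- by rewrite (ltn_trans h1 h2).
- by rewrite -h2 h1.
- by rewrite h1 h2.
have [_ anti trans _] := out_le_linear F (src e).
have [ie jf kg] : [/\ e \in Out (src e), f \in Out (src e) & g \in Out (src e)].
  by rewrite !inE h1 h2 !eqxx.
rewrite -h1 in l2 h2; rewrite -h2 eqxx (trans f e g) //= andbT.
apply/orP; right; apply: contra n1 => /eqP eg; rewrite -eg in l2.
by apply/eqP/anti; rewrite ?l1.
Qed.

Lemma in_lt_total e f : e != f -> in_lt e f || in_lt f e.
Proof.
move=> ef; rewrite /in_lt [f == e]eq_sym ef [tgt f == _]eq_sym /=.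
case: (ltngtP (tgt e) (tgt f)) => [//|_|/val_inj h]; first by rewrite orbT.
rewrite h eqxx /=.
have [_ _ _ tot] := in_le_linear F (tgt f).
by apply: tot; rewrite inE ?h.
Qed.

Lemma out_lt_total e f : e != f -> out_lt e f || out_lt f e.
Proof.
move=> ef; rewrite /out_lt [f == e]eq_sym ef [src f == _]eq_sym /=.
case: (ltngtP (src e) (src f)) => [//|_|/val_inj h]; first by rewrite orbT.
rewrite h eqxx /=.
have [_ _ _ tot] := out_le_linear F (src f).
by apply: tot; rewrite inE ?h.
Qed.

(** Prefixes are compared from their last edge backwards, hence [rev]. *)
Definition in_rank v P : nat := rank in_lt (fun Q => rev (prefix_at Q v)) P.
Definition out_rank v P : nat := rank out_lt (fun Q => suffix_at Q v) P.

Lemma in_rank_lt v P Q : (in_rank v P < in_rank v Q) =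
  lexlt in_lt (rev (prefix_at P v)) (rev (prefix_at Q v)).
Proof. exact: (rank_lt in_lt_irr in_lt_trans in_lt_total). Qed.

Lemma out_rank_lt v P Q : (out_rank v P < out_rank v Q) =
  lexlt out_lt (suffix_at P v) (suffix_at Q v).
Proof. exact: (rank_lt out_lt_irr out_lt_trans out_lt_total). Qed.

Lemma in_rank_eq v P Q :
  in_rank v P = in_rank v Q <-> prefix_at P v = prefix_at Q v.
Proof.
rewrite (rank_eq in_lt_irr in_lt_trans in_lt_total); split=> [|-> //].
exact: (inv_inj revK).
Qed.

Lemma out_rank_eq v P Q :
  out_rank v P = out_rank v Q <-> suffix_at P v = suffix_at Q v.
Proof. exact: (rank_eq out_lt_irr out_lt_trans out_lt_total). Qed.

Lemma agreeP u v P Q : reflect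
  [/\ u <= v, u \in vertices P /\ v \in vertices P, u \in vertices Q /\ v \in vertices Q
    & segment P u v = segment Q u v]
  (agree P Q u v).
Proof.
apply: (iffP idP) => [/and5P[uv tPu tQu tPv /andP[tQv /eqP eq]]|[uv [h1 h2] [h3 h4] eq]].
  by split.
by rewrite /agree uv h1 h2 h3 h4 eq eqxx.
Qed.

Lemma flow_pos_copos v : v + (((fg_n G).+1) - v) = (fg_n G).+1.
Proof. by have := ltn_ord v; lia. Qed.

Lemma flow_pos_sink v : v <= @ord_max (fg_n G).+1.
Proof. by have := ltn_ord v; rewrite /=; lia. Qed.

Lemma flow_visits_source P : ord0 \in vertices P.
Proof. by rewrite inE eqxx. Qed.

Lemma flow_visits_sink P : ord_max \in vertices P.
Proof. exact: walk_end_mem (route_walk P). Qed.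

Lemma flow_pre_source P Q : in_rank ord0 P = in_rank ord0 Q.
Proof.
apply/in_rank_eq; have h (R : route G) : prefix_at R ord0 = [::].
  by have [_ -> _] := @cut2 G R ord0 [::] R erefl (eqxx _) (route_walk R).
by rewrite !h.
Qed.

Lemma flow_suf_sink P Q : out_rank ord_max P = out_rank ord_max Q.
Proof.
apply/out_rank_eq; have h (R : route G) : suffix_at R ord_max = [::].
  have eR : R = R ++ [::] :> seq _ by rewrite cats0.
  by have [_ _ ->] := cut2 eR (route_walk R) (eqxx _).
by rewrite !h.
Qed.

Lemma flow_route_ext v P Q : v \in vertices P -> v \in vertices Q ->
  in_rank v P = in_rank v Q -> out_rank v P = out_rank v Q -> P = Q.
Proof.
move=> /cut2_ex[eP _ _] /cut2_ex[eQ _ _] /in_rank_eq ea /out_rank_eq eb.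
by apply: route_inj; rewrite eP eQ ea eb.
Qed.

Lemma flow_agrees_visits u v P Q : agree P Q u v ->
  [/\ u <= v, u \in vertices P, v \in vertices P, u \in vertices Q & v \in vertices Q].
Proof. by case/agreeP=> ? [? ?] [? ?] _. Qed.

Lemma flow_agrees_refl u v P : u <= v -> u \in vertices P -> v \in vertices P -> agree P P u v.
Proof. by move=> *; apply/agreeP. Qed.

Lemma flow_agrees_sym u v P Q : agree P Q u v -> agree Q P u v.
Proof. by case/agreeP=> *; apply/agreeP. Qed.

Lemma flow_agrees_trans u v P Q S : agree P Q u v -> agree Q S u v -> agree P S u v.
Proof. by case/agreeP=> ? ? ? e /agreeP[? ? ? e']; apply/agreeP; rewrite e. Qed.

Lemma flow_agrees_pre u v P Q : agree P Q u v ->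
  (in_rank u P < in_rank u Q) = (in_rank v P < in_rank v Q).
Proof.
case/agreeP=> uv [Pu Pv] [Qu Qv] e; rewrite !in_rank_lt.
have [-> _] := segment_cat Pu Pv uv; have [-> _] := segment_cat Qu Qv uv.
by rewrite e !rev_cat (lexlt_cat2l in_lt_irr).
Qed.

Lemma flow_agrees_suf u v P Q : agree P Q u v ->
  (out_rank u P < out_rank u Q) = (out_rank v P < out_rank v Q).
Proof.
case/agreeP=> uv [Pu Pv] [Qu Qv] e; rewrite !out_rank_lt.
have [_ ->] := segment_cat Pu Pv uv; have [_ ->] := segment_cat Qu Qv uv.
by rewrite e (lexlt_cat2l out_lt_irr).
Qed.

Lemma flow_pre_agrees u v P Q : in_rank v P = in_rank v Q -> v \in vertices P ->
  v \in vertices Q -> u <= v -> u \in vertices P -> agree P Q u v.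
Proof.
move=> /in_rank_eq e Pv Qv uv Pu; have [_ w1 w2 _] := cut3_ex Pu Pv uv.
have [eQ _ w4] := cut2_ex Qv; have [ep _] := segment_cat Pu Pv uv.
rewrite -e ep -catA in eQ; have [[_ Qu _] es _ _] := cut3 eQ w1 w2 w4.
by apply/agreeP; rewrite es.
Qed.

Lemma flow_suf_agrees u v P Q : out_rank u P = out_rank u Q -> u \in vertices P ->
  u \in vertices Q -> u <= v -> v \in vertices P -> agree P Q u v.
Proof.
move=> /out_rank_eq e Pu Qu uv Pv; have [_ _ w2 w3] := cut3_ex Pu Pv uv.
have [eQ w1 _] := cut2_ex Qu; have [_ ep] := segment_cat Pu Pv uv.
rewrite -e ep in eQ; have [[_ _ Qv] es _ _] := cut3 eQ w1 w2 w3.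
by apply/agreeP; rewrite es.
Qed.

Lemma flow_pre_diverge u v P P' Q : agree P P' u v -> v \in vertices Q ->
  (in_rank v P < in_rank v Q -> agree P Q u v \/ in_rank v P' < in_rank v Q) /\
  (in_rank v Q < in_rank v P -> agree P Q u v \/ in_rank v Q < in_rank v P').
Proof.
case/agreeP=> uv [Pu Pv] [P'u P'v] e Qv; rewrite !in_rank_lt.
have [_ _ w2 _] := cut3_ex Pu Pv uv.
have [-> _] := segment_cat Pu Pv uv; have [-> _] := segment_cat P'u P'v uv.
rewrite -e !rev_cat; set s := segment P u v in e w2 *.
have agrees : prefix (rev s) (rev (prefix_at Q v)) -> agree P Q u v.
  case/prefixP=> z /(congr1 rev); rewrite revK rev_cat revK => ez.
  have [eQ w1 w3] := cut2_ex Qv; rewrite ez in w1.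
  have [x wz wx] := walk_split w1; rewrite (walk_start wx w2) in wz.
  rewrite ez -catA in eQ; have [[_ Qu _] es _ _] := cut3 eQ wz w2 w3.
  by apply/agreeP; rewrite es.
have [h1 h2] := lexlt_div in_lt (rev s) (rev (prefix_at P u)) (rev (prefix_at P' u))
  (rev (prefix_at Q v)).
by split=> [/h1|/h2] [/agrees|]; [left|right|left|right].
Qed.

Lemma flow_suf_diverge u v P P' Q : agree P P' u v -> u \in vertices Q ->
  (out_rank u P < out_rank u Q -> agree P Q u v \/ out_rank u P' < out_rank u Q) /\
  (out_rank u Q < out_rank u P -> agree P Q u v \/ out_rank u Q < out_rank u P').
Proof.
case/agreeP=> uv [Pu Pv] [P'u P'v] e Qu; rewrite !out_rank_lt.
have [_ _ w2 _] := cut3_ex Pu Pv uv.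
have [_ ->] := segment_cat Pu Pv uv; have [_ ->] := segment_cat P'u P'v uv.
rewrite -e; set s := segment P u v in e w2 *.
have agrees : prefix s (suffix_at Q u) -> agree P Q u v.
  case/prefixP=> z ez; have [eQ w1 w3] := cut2_ex Qu; rewrite ez in w3.
  have [x wx wz] := walk_split w3; rewrite (walk_end wx w2) in wz.
  rewrite ez in eQ; have [[_ _ Qv] es _ _] := cut3 eQ w1 w2 wz.
  by apply/agreeP; rewrite es.
have [h1 h2] := lexlt_div out_lt s (suffix_at P v) (suffix_at P' v) (suffix_at Q u).
by split=> [/h1|/h2] [/agrees|]; [left|right|left|right].
Qed.

Lemma flow_glue v P Q : v \in vertices P -> v \in vertices Q ->
  [/\ v \in vertices (splice v P Q), in_rank v (splice v P Q) = in_rank v P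
    & out_rank v (splice v P Q) = out_rank v Q].
Proof.
move=> Pv Qv; have [? ? ?] := spliceP Pv Qv.
by split=> //; [apply/in_rank_eq|apply/out_rank_eq].
Qed.

Definition flow_system : route_system := {|
  sroute := route G; svertex := vertex G; pos := @nat_of_ord _;
  copos := fun v => (fg_n G).+1 - v; depth := (fg_n G).+1;
  pos_copos := flow_pos_copos; pos_inj := @ord_inj _; source := ord0; sink := ord_max;
  pos_source := fun v => leq0n v; pos_sink := flow_pos_sink; source_lt_sink := isT;
  visits := fun P v => v \in vertices P;
  visits_source := flow_visits_source; visits_sink := flow_visits_sink;
  pre := in_rank; suf := out_rank; pre_source := flow_pre_source; suf_sink := flow_suf_sink;
  route_ext := flow_route_ext; agrees := fun u v P Q => agree P Q u v;
  agrees_visits := flow_agrees_visits; agrees_refl := flow_agrees_refl;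
  agrees_sym := flow_agrees_sym;
  agrees_trans := flow_agrees_trans; agrees_sub := fun u w v P Q => @agree_sub G u w v P Q;
  agrees_cat := fun u w v P Q => @agree_cat G u w v P Q;
  agrees_pre := flow_agrees_pre; agrees_suf := flow_agrees_suf;
  pre_agrees := flow_pre_agrees; suf_agrees := flow_suf_agrees;
  pre_diverge := flow_pre_diverge; suf_diverge := flow_suf_diverge;
  glue := @splice G; glueP := flow_glue |}.

Lemma last_in_edge R w r h z :
  (R : route G) = (r ++ [:: h]) ++ suffix_at R w :> seq _ ->
  w \in vertices R -> walk ord0 r z -> src h = z -> tgt h = w ->
  {in (R : seq _), forall g, tgt g = w -> g = h}.
Proof.
move=> eR Rw wr hz hw g; rewrite eR !mem_cat mem_seq1 => /orP[/orP[|/eqP//]|].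
  have [_ _ br] := walk_bounds wr; move/br => -[_ gz] gw'.
  by have := leq_trans (src_lt_tgt h) _; rewrite hw -gw' hz => /(_ _ gz); rewrite ltnn.
have [_ _ /walk_bounds[_ _ bs]] := cut2_ex Rw; move/bs => -[wg _] gw'.
by have := leq_ltn_trans wg (src_lt_tgt g); rewrite gw' ltnn.
Qed.

Lemma first_out_edge R w r h :
  (R : route G) = prefix_at R w ++ h :: r :> seq _ ->
  w \in vertices R -> walk (tgt h) r ord_max -> src h = w ->
  {in (R : seq _), forall g, src g = w -> g = h}.
Proof.
move=> eR Rw wr hw g; rewrite eR mem_cat inE => /or3P[|/eqP//|].
  have [_ /walk_bounds[_ _ bs] _] := cut2_ex Rw; move/bs => -[_ gw] gw'.
  by have := leq_trans (src_lt_tgt g) gw; rewrite gw' ltnn.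
have [_ _ br] := walk_bounds wr; move/br => -[hg _] gw'.
by have := leq_trans (src_lt_tgt h) hg; rewrite gw' hw ltnn.
Qed.

(** The split vertex w is the start of the common end of the two prefixes; the
    first difference of the reversed prefixes is at the edges entering w. *)
Lemma ltI_visits v P Q : v \in vertices P -> v \in vertices Q ->
  ltI F v P Q = (in_rank v P < in_rank v Q).
Proof.
move=> Pv Qv.
have [|w gw wmin] := @ex_argmin _ [pred x | agree P Q x v] (fun x : vertex G => x : nat).
  by exists v; apply: (@agrees_diag flow_system).
have sw x : split_in v P Q x -> x = w.
  case/andP=> gx /forallP/(_ w)/implyP/(_ gw) xw; apply/val_inj/eqP.
  by rewrite eqn_leq xw wmin.
have ws : split_in v P Q w.
  by apply/andP; split=> //; apply/forallP => x; apply/implyP => /wmin.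
have [wv [Pw _] [Qw _] eseg] := agreeP _ _ _ _ gw.
have [_ _ w3 w4] := cut3_ex Pw Pv wv; have [_ _ _ w4'] := cut3_ex Qw Qv wv.
have [eP wp _] := cut2_ex Pw; have [eQ wq _] := cut2_ex Qw.
have [_ sP] := segment_cat Pw Pv wv; have [_ sQ] := segment_cat Qw Qv wv.
rewrite -(flow_agrees_pre gw).
case: (eqVneq w ord0) => [w0|nw].
  rewrite w0 (flow_pre_source P Q) ltnn; apply/negbTE/existsPn => x.
  apply/negP => /andP[/sw-> /exists_inP[e]]; rewrite inE w0 => /eqP e0 _.
  by have := src_lt_tgt e; rewrite e0.
case/lastP: (prefix_at P w) (in_rank_lt w P Q) eP wp => [|p e] rk eP wp.
  by move: nw; rewrite -(eqP wp) eqxx.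
case/lastP: (prefix_at Q w) rk eQ wq => [|q f] rk eQ wq.
  by move: nw; rewrite -(eqP wq) eqxx.
rewrite -cats1 in eP wp; rewrite -cats1 in eQ wq.
have [x wpx /= /andP[/eqP ex /eqP ew]] := walk_split wp.
have [y wqy /= /andP[/eqP fy /eqP fw]] := walk_split wq.
have enf : e != f.
  apply: contraTneq (src_lt_tgt e) => ef; rewrite -leqNgt ew.
  have wev : walk x (e :: segment P w v) v by rewrite /= ex eqxx ew w3.
  have ePx : P = p ++ (e :: segment P w v) ++ suffix_at P v :> seq _.
    by rewrite {1}eP sP -catA.
  have eQx : Q = q ++ (e :: segment P w v) ++ suffix_at Q v :> seq _.
    by rewrite {1}eQ sQ ef eseg -catA.
  have exy : y = x by rewrite -ex -fy ef.
  rewrite exy in wqy; have [[xv Px _] s1 _ _] := cut3 ePx wpx wev w4.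
  have [[_ Qx _] s2 _ _] := cut3 eQx wqy wev w4'.
  by rewrite ex; apply: wmin; apply/agreeP; rewrite s1 s2.
have eE := last_in_edge eP Pw wpx ex ew; have fE := last_in_edge eQ Qw wqy fy fw.
have eIn : e \in (P : seq _) by rewrite eP !mem_cat mem_seq1 eqxx orbT.
have fIn : f \in (Q : seq _) by rewrite eQ !mem_cat mem_seq1 eqxx orbT.
rewrite rk !rev_rcons /= (negPf enf) orbF /in_lt ew fw ltnn eqxx enf /=.
apply/existsP/idP => [[z /andP[/sw-> /exists_inP[e' + /exists_inP[f' +]]]]|le].
  rewrite !inE => /eqP e'w /eqP f'w /and4P[e'P f'Q _].
  by rewrite (eE e' e'P e'w) (fE f' f'Q f'w).
exists w; rewrite ws; apply/exists_inP; exists e; first by rewrite inE ew.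
by apply/exists_inP; exists f; rewrite ?inE ?fw // eIn fIn enf.
Qed.

Lemma ltO_visits v P Q : v \in vertices P -> v \in vertices Q ->
  ltO F v P Q = (out_rank v P < out_rank v Q).
Proof.
move=> Pv Qv.
have [|w gw wmax] := @ex_argmax _ [pred x | agree P Q v x] (fun x : vertex G => x : nat).
  by exists v; apply: (@agrees_diag flow_system).
have sw x : split_out v P Q x -> x = w.
  case/andP=> gx /forallP/(_ w)/implyP/(_ gw) xw; apply/val_inj/eqP.
  by rewrite eqn_leq xw wmax.
have ws : split_out v P Q w.
  by apply/andP; split=> //; apply/forallP => x; apply/implyP => /wmax.
have [vw [_ Pw] [_ Qw] eseg] := agreeP _ _ _ _ gw.
have [_ w1 w2 _] := cut3_ex Pv Pw vw; have [_ w1' _ _] := cut3_ex Qv Qw vw.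
have [eP _ wp] := cut2_ex Pw; have [eQ _ wq] := cut2_ex Qw.
have [sP _] := segment_cat Pv Pw vw; have [sQ _] := segment_cat Qv Qw vw.
rewrite (flow_agrees_suf gw).
case: (eqVneq w ord_max) => [wn|nw].
  rewrite wn (flow_suf_sink P Q) ltnn; apply/negbTE/existsPn => x.
  apply/negP => /andP[/sw-> /exists_inP[e]]; rewrite inE wn => /eqP e0 _.
  by have := leq_trans (src_lt_tgt e) (flow_pos_sink (tgt e)); rewrite e0 ltnn.
case: (suffix_at P w) (out_rank_lt w P Q) eP wp => [|e p] rk eP wp.
  by rewrite (eqP wp) eqxx in nw.
case: (suffix_at Q w) rk eQ wq => [|f q] rk eQ wq.
  by rewrite (eqP wq) eqxx in nw.
have /andP[/eqP ew wpe] := wp; have /andP[/eqP fw wqf] := wq.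
have enf : e != f.
  apply: contraTneq (src_lt_tgt e) => ef; rewrite -leqNgt ew.
  have wev : walk v (segment P v w ++ [:: e]) (tgt e).
    by apply: walk_cat w2 _; rewrite /= ew !eqxx.
  have ePx : P = prefix_at P v ++ (segment P v w ++ [:: e]) ++ p :> seq _.
    by rewrite {1}eP sP -!catA.
  have eQx : Q = prefix_at Q v ++ (segment P v w ++ [:: e]) ++ q :> seq _.
    by rewrite {1}eQ sQ ef eseg -!catA.
  rewrite -ef in wqf; have [[xv _ Px] s1 _ _] := cut3 ePx w1 wev wpe.
  have [[_ _ Qx] s2 _ _] := cut3 eQx w1' wev wqf.
  by apply: wmax; apply/agreeP; rewrite s1 s2.
have eE := first_out_edge eP Pw wpe ew; have fE := first_out_edge eQ Qw wqf fw.
have eIn : e \in (P : seq _) by rewrite eP mem_cat inE eqxx orbT.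
have fIn : f \in (Q : seq _) by rewrite eQ mem_cat inE eqxx orbT.
rewrite rk /= (negPf enf) orbF /out_lt ew fw ltnn eqxx enf /=.
apply/existsP/idP => [[z /andP[/sw-> /exists_inP[e' + /exists_inP[f' +]]]]|le].
  rewrite !inE => /eqP e'w /eqP f'w /and4P[e'P f'Q _].
  by rewrite (eE e' e'P e'w) (fE f' f'Q f'w).
exists w; rewrite ws; apply/exists_inP; exists e; first by rewrite inE ew.
by apply/exists_inP; exists f; rewrite ?inE ?fw // eIn fIn enf.
Qed.

End FlowSystem.

(** * Cliques and the framing lattice *)

Section Dictionary.
Variables (G : flow_graph) (F : framing G).
Let Sy := flow_system F.
Implicit Types (P Q R : route G) (u v w : vertex G) (S A : {set route G}).

Lemma incoherent_atE v P Q :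
  incoherent_at F v P Q = @cw Sy v P Q || @cw Sy v Q P.
Proof.
rewrite /incoherent_at /cw /=.
case tP: (v \in vertices P); case tQ: (v \in vertices Q);
  rewrite /= ?andbF //.
rewrite !ltI_visits // !ltO_visits //.
case: (eqVneq v ord0) => [->|n0] /=.
  by rewrite (flow_pre_source F P Q) ltnn.
case: (eqVneq v ord_max) => [->|n1] //=.
by rewrite (flow_suf_sink F P Q) ltnn !andbF.
Qed.

Lemma coherentP P Q : reflect (@compatible Sy P Q) (coherent F P Q).
Proof.
apply: (iffP forallP) => [h|[h1 h2] v]; last first.
  by rewrite incoherent_atE negb_or h1 h2.
by split=> v; have := h v; rewrite incoherent_atE negb_or => /andP[].
Qed.

Lemma cliqueP S : reflect (@compatible_family Sy S) (clique F S).
Proof.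
apply: (iffP forall_inP) => [h P Q PS QS|h P PS].
  by have /forall_inP/(_ Q QS)/coherentP[] := h P PS.
by apply/forall_inP => Q QS; apply/coherentP; split; apply: h.
Qed.

(** If R' were to the upper left of R at v, the condition [leI] would force equal
    prefixes at v. *)
Lemma cw_ltP P Q : reflect (exists v, @cw Sy v P Q) (cw_lt F P Q).
Proof.
apply: (iffP existsP) => -[v h]; exists v.
  move: h; rewrite incoherent_atE => /and3P[/orP[//|level] lI _].
  have /and4P[/= tQ tP lt _] := level; move: lI; rewrite /leI ltI_visits //.
  rewrite ltnNge (ltnW lt) /= => /andP[g _].
  have := flow_agrees_pre F g; have := flow_agrees_pre F (flow_agrees_sym g).
  by rewrite !(flow_pre_source F P Q) !ltnn lt.
rewrite incoherent_atE h /=; have /and4P[/= tP tQ l1 l2] := h.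
by rewrite /leI /leO ltI_visits // ltO_visits // l1 l2.
Qed.

Lemma walk_from_source v : exists p, walk (ord0 : vertex G) p v.
Proof.
elim: {v}(nat_of_ord v) {-2}v (leqnn v) => [|n IH] v vn.
  by exists [::]; apply/eqP/val_inj; move: vn; rewrite leqn0 => /eqP.
case: (eqVneq v ord0) => [->|nv]; first by exists [::]; rewrite /=.
have [e ev] := source_unique nv; have := src_lt_tgt e; rewrite ev => lt.
have [|p wp] := IH (src e); first by rewrite -ltnS (leq_trans lt).
by exists (p ++ [:: e]); apply: walk_cat wp _; rewrite /= ev !eqxx.
Qed.

Lemma walk_to_sink v : exists p, walk v p (ord_max : vertex G).
Proof.
have [n] := ubnP ((fg_n G).+2 - v); elim: n v => [//|n IH] v vn.
case: (eqVneq v ord_max) => [->|nv]; first by exists [::]; rewrite /=.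
have [e ev] := sink_unique nv; have := src_lt_tgt e; rewrite ev => lt.
have [|p wp] := IH (tgt e).
  by move: vn lt; have := ltn_ord (tgt e); clear; lia.
by exists (e :: p); rewrite /= ev eqxx.
Qed.

Lemma edge_route e : exists2 R : route G, e \in (R : seq _) &
  @consecutive Sy (src e) (tgt e) R /\ segment R (src e) (tgt e) = [:: e].
Proof.
have [p wp] := walk_from_source (src e); have [q wq] := walk_to_sink (tgt e).
have we : walk (src e) [:: e] (tgt e) by rewrite /= !eqxx.
have [R eR] := route_ex (walk_cat wp (walk_cat we wq)).
have [[_ tu tv] es [ep _] [_ eq]] := cut3 eR wp we wq.
exists R; first by rewrite eR mem_cat mem_cat mem_seq1 eqxx orbT.
split=> //; split=> //; first exact: src_lt_tgt.
move=> x /=; rewrite /vertices eR !map_cat /= -cat_cons mem_cat => /orP[xp|].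
  left; have [p1 [p2 [_ _ w2]]] := walk_visit wp xp.
  by case: (walk_bounds w2).
rewrite inE => /predU1P[->|/mapP[f fq ->]]; first by right.
by right; have [_ _ /(_ f fq)[h _]] := walk_bounds wq; rewrite (leq_trans h) // ltnW ?src_lt_tgt.
Qed.

(** The pairs of consecutive vertices of routes are the edges of the graph, since
    every edge lies on a route. *)
Lemma coversP S : reflect (@covering Sy S) (covers S).
Proof.
apply: (iffP forallP) => [h R u v [/= tu tv uv nx]|h e].
  have [eR w1 w2 w3] := cut3_ex tu tv (ltnW uv).
  have [e es] : exists e, segment R u v = [:: e].
    case es: (segment R u v) w2 => [|e s] /=.
      by move=> /eqP e; rewrite e ltnn in uv.
    case/andP=> /eqP eu ws; exists e; congr (_ :: _).
    have te : tgt e \in vertices R.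
      have : e \in segment R u v by rewrite es inE eqxx.
      by rewrite mem_filter => /andP[_ eRm]; rewrite /vertices inE map_f ?orbT.
    have [tv' sz _] := walk_bounds ws; have lt := src_lt_tgt e.
    case: (nx _ te) => hx; first by rewrite eu ltnNge hx in lt.
    apply/eqP; rewrite -size_eq0 -leqn0 -(leq_add2r (tgt e)) (leq_trans sz) //.
  have /exists_inP[Z ZS eZ] := h e; exists Z => //.
  have /andP[/eqP eu /eqP ev] : walk u [:: e] v by rewrite -es.
  have [p [q eqZ]] : exists p q, Z = p ++ e :: q :> seq _.
    by case/splitPr: eZ => p q; exists p, q.
  have := route_walk Z; rewrite eqZ => /walk_split[x wp /andP[/eqP ex wq]].
  have we : walk x [:: e] (tgt e) by rewrite /= ex !eqxx.
  have [[_ Zu Zv] sZ _ _] := cut3 (eqZ : Z = p ++ [:: e] ++ q :> seq _) wp we wq.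
  rewrite -ex eu ev in Zu Zv sZ.
  by apply/agreeP; split=> //; [exact: ltnW|rewrite es sZ].
have [R _ [cR sR]] := edge_route e; have [Z ZS /agreeP[_ _ _ eZ]] := h R _ _ cR.
apply/exists_inP; exists Z => //.
have : e \in segment Z (src e) (tgt e) by rewrite -eZ sR inE eqxx.
by rewrite mem_filter => /andP[].
Qed.

Lemma maximal_familyP S : reflect (@maximal_family Sy S) (maxset (clique F) S).
Proof.
apply: (iffP maxsetP) => [[/cliqueP cS maxS]|[cS maxS]].
  split=> // X hX; suff <- : X |: S = S by rewrite setU11.
  apply: maxS; last exact: finset.subsetUr.
  apply/cliqueP => P Q /setU1P[->|PS] /setU1P[->|QS]; first exact: ncw_refl.
  - by case: (hX Q QS).
  - by case: (hX P PS).
  - exact: cS.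
split; first exact/cliqueP.
move=> B /cliqueP cB SB; apply/eqP; rewrite eqEsubset SB andbT.
apply/subsetP => X XB; apply: maxS => Y /(subsetP SB) YB.
by split; apply: cB.
Qed.

Definition to_max_clique (C : {set route G}) (mC : @maximal_family Sy C) : max_clique F :=
  exist _ C (introT (maximal_familyP C) mC).

Lemma max_clique_maximal (C : max_clique F) : @maximal_family Sy (val C).
Proof. by apply/maximal_familyP; case: C. Qed.

Implicit Types C D E : max_clique F.

Lemma rotationP C R D : reflect
  (exists v P Q, @corner Sy (val C) v P R Q /\ val D = @flip Sy v P R Q (val C))
  (rotation C R D).
Proof.
have mC := max_clique_maximal C; have mD := max_clique_maximal D.
apply: (iffP and3P) => [[_ RC /existsP[X /andP[/eqP eD /cw_ltP[z cz]]]]|].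
  exact: (rotation_flip mC mD RC eD cz).
case=> v [P [Q [k eD]]]; have [_ XC cX _ _] := flipP mC k.
have [_ RC _] := corner_mem k.
split=> //.
  apply: contraNneq XC => e; rewrite e eD; exact: setU11.
apply/existsP; exists (splice v Q P); rewrite eD eqxx /=.
by apply/cw_ltP; exists v.
Qed.

Lemma corner_rotation C v P R Q : @corner Sy (val C) v P R Q ->
  exists2 D, rotation C R D & val D = @flip Sy v P R Q (val C).
Proof.
move=> k; have [mD _ _ _ _] := flipP (max_clique_maximal C) k.
by exists (to_max_clique mD) => //; apply/rotationP; exists v, P, Q.
Qed.

Lemma max_clique_antisym C D :
  @below Sy (val C) (val D) -> @below Sy (val D) (val C) -> C = D.
Proof.
by move=> CD DC; apply/val_inj/(below_antisym _ _ CD DC); apply: max_clique_maximal.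
Qed.

(** Flips go up for [below]; conversely [below_step] is iterated, and it terminates
    because the set of the maximal cliques above C shrinks. *)
Lemma framing_leP C D : reflect (@below Sy (val C) (val D)) (framing_le C D).
Proof.
apply: (iffP idP) => [/connectP[p]|].
  elim: p C => [|E p IH] C /=; first
    by move=> _ ->; apply: below_refl; case: (max_clique_maximal C).
  case/andP=> /existsP[R /rotationP[v [P [Q [k eE]]]]] pE eD.
  have [mE _ _ CE _] := flipP (max_clique_maximal C) k; rewrite -eE in mE CE.
  exact: below_trans (max_clique_maximal C) mE (max_clique_maximal D) CE (IH E pE eD).
pose m C := #|[set E : max_clique F | `[< @below Sy (val C) (val E) >]]|.
have [n] := ubnP (m C); elim: n C => [//|n IH] C mn CD.
case: (eqVneq C D) => [->|nCD]; first exact: connect0.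
have nv : val C != val D by apply: contra nCD => /eqP/val_inj->.
have [v [P [R [Q [k flipD]]]]] := below_step (max_clique_maximal C) (max_clique_maximal D) CD nv.
have [E rE eE] := corner_rotation k; rewrite -eE in flipD.
have [_ _ _ CE _] := flipP (max_clique_maximal C) k; rewrite -eE in CE.
apply: (connect_trans (y := E)); first by apply: connect1; apply/existsP; exists R.
apply: IH flipD; apply: leq_trans (_ : m C <= n); last by rewrite -ltnS.
apply: proper_card; apply/properP; split.
  apply/subsetP => B; rewrite !inE => /asboolP EB; apply/asboolP.
  exact: below_trans (max_clique_maximal C) (max_clique_maximal E) (max_clique_maximal B) CE EB.
exists C; rewrite inE; first by apply/asboolP/below_refl; case: (max_clique_maximal C).
apply/asboolP => EC; have [_ XC _ _ _] := flipP (max_clique_maximal C) k.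
by move: XC; rewrite (max_clique_antisym CE EC) eE setU11.
Qed.

Definition star S : {set max_clique F} := [set C : max_clique F | S \subset val C].

Lemma starE S C D : S \subset val C -> S \subset val D ->
  (forall E, S \subset val E -> @below Sy (val C) (val E)) ->
  (forall E, S \subset val E -> @below Sy (val E) (val D)) ->
  star S = framing_interval C D.
Proof.
move=> SC SD least greatest; apply/setP => E; rewrite !inE.
apply/idP/andP => [SE|[/framing_leP CE /framing_leP ED]].
  by split; apply/framing_leP; [apply: least|apply: greatest].
exact: star_sandwich (max_clique_maximal E) SC SD CE ED.
Qed.

Lemma star_top S : @compatible_family Sy S -> exists2 D : max_clique F, S \subset val D &
  forall E, S \subset val E -> @below Sy (val E) (val D).
Proof.
move=> cS; have [D [mD SD Dtop]] := star_greatest cS.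
by exists (to_max_clique mD) => // E SE; apply: Dtop => //; apply: max_clique_maximal.
Qed.

Lemma star_bot S : @compatible_family Sy S -> exists2 D : max_clique F, S \subset val D &
  forall E, S \subset val E -> @below Sy (val D) (val E).
Proof.
move=> /family_swap cS; have [D [/maximal_family_swap mD SD Dbot]] := star_greatest cS.
exists (to_max_clique mD) => // E SE; apply/below_swap/Dbot => //.
by apply/maximal_family_swap/max_clique_maximal.
Qed.

Lemma AscP C R : R \in Asc C <-> exists v P Q, @corner Sy (val C) v P R Q.
Proof.
rewrite inE; split=> [/andP[RC /existsP[D /rotationP[v [P [Q [k _]]]]]]|].
  by exists v, P, Q.
case=> v [P [Q k]]; have [_ -> _] := corner_mem k.
by have [D rD _] := corner_rotation k; apply/existsP; exists D.
Qed.

Lemma is_join_uniq (X : {set max_clique F}) D E :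
  is_join X D -> is_join X E -> D = E.
Proof.
move=> /andP[uD /forallP lD] /andP[uE /forallP lE].
apply: max_clique_antisym; apply/framing_leP.
  by apply: (implyP (lD E)).
by apply: (implyP (lE D)).
Qed.

Lemma is_plus_uniq C A D E : is_plus C A D -> is_plus C A E -> D = E.
Proof.
by rewrite /is_plus; case: ifP => _; [move=> /eqP-> /eqP->|apply: is_join_uniq].
Qed.

(** The greatest element D of the star of C minus A is above all flips of A, which
    belong to this star, and by [flips_below] it is below their upper bounds. *)
Lemma star_is_plus C A D : A \subset Asc C ->
  val C :\: A \subset val D ->
  (forall E, val C :\: A \subset val E -> @below Sy (val E) (val D)) ->
  is_plus C A D.
Proof.
move=> /subsetP AAsc SD Dtop; rewrite /is_plus; case: eqVneq => [A0|nA].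
  move: SD; rewrite A0 setD0 => CD; have [cD _] := max_clique_maximal D.
  by apply/eqP/max_clique_antisym => P Q PD QC; apply: cD => //; apply: (subsetP CD).
apply/andP; split.
  apply/forall_inP => E; rewrite inE => /exists_inP[R RA /rotationP[v [P [Q [k eE]]]]].
  apply/framing_leP/Dtop; rewrite eE.
  have [] // := flip_superset k (subsetDl (val C) A).
  by rewrite !inE RA.
apply/forallP => E; apply/implyP => /forall_inP upE; apply/framing_leP.
have rE R D' : R \in A -> rotation C R D' -> @below Sy (val D') (val E).
  by move=> RA r; apply/framing_leP/upE; rewrite inE; apply/exists_inP; exists R.
have [R0 R0A] := set0Pn _ nA.
have CE : @below Sy (val C) (val E).
  have [v [P [Q k]]] := proj1 (AscP C R0) (AAsc R0 R0A).
  have [D' r eD'] := corner_rotation k; have [_ _ _ CD' _] := flipP (max_clique_maximal C) k.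
  rewrite -eD' in CD'; apply: below_trans (max_clique_maximal C) (max_clique_maximal D')
    (max_clique_maximal E) CD' (rE R0 D' R0A r).
move=> R R' RD R'E.
apply: (flips_below (max_clique_maximal C) (subsetDl (val C) A) CE _ _ R'E).
  move=> X /setDP[XC]; rewrite inE XC andbT negbK => XA.
  have [v [P [Q k]]] := proj1 (AscP C X) (AAsc X XA).
  have [D' r eD'] := corner_rotation k; exists v, P, Q; split=> // Y YE.
  apply: (rE X D' XA r) => //; rewrite eD'; exact: setU11.
move=> Y /(subsetP SD) YD; by case: (max_clique_maximal D) => cD _; apply: cD.
Qed.

Lemma star_pure S : @compatible_family Sy S -> @covering Sy S -> pure_intervals F (star S).
Proof.
move=> cS covS; have [C SC Cbot] := star_bot cS; have [D SD Dtop] := star_top cS.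
have hC : {in val C :\: S, forall R, exists v P Q, @corner Sy (val C) v P R Q}.
  apply: least_corners covS (max_clique_maximal C) SC _ => E mE SE.
  exact: (Cbot (to_max_clique mE)).
have eS : val C :\: (val C :\: S) = S by rewrite setDDr setDv set0U; apply/setIidPr.
exists C, (val C :\: S), D; split; last exact: starE.
  by apply/subsetP => R /hC/AscP.
by apply: star_is_plus; rewrite ?eS //; apply/subsetP => R /hC/AscP.
Qed.

Lemma pure_star I : pure_intervals F I ->
  exists S, [/\ @compatible_family Sy S, @covering Sy S & I = star S].
Proof.
case=> C [A [D [AAsc CAD ->]]]; pose S := val C :\: A.
have SC : S \subset val C := subsetDl _ _.
have [cC _] := max_clique_maximal C; have cS := @family_sub Sy _ _ SC cC.
have hC : {in val C :\: S, forall R, exists v P Q, @corner Sy (val C) v P R Q}.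
  move=> R /setDP[RC]; rewrite inE RC andbT negbK => RA.
  by apply/AscP/(subsetP AAsc).
have [D' SD Dtop] := star_top cS.
have eD : D = D' by apply: is_plus_uniq CAD (star_is_plus AAsc SD Dtop).
exists S; split=> //; first exact: covering_setD (max_clique_maximal C) hC SC.
rewrite eD; apply/esym/starE => // E SE.
exact: corners_least (max_clique_maximal C) SC hC _ (max_clique_maximal E) SE.
Qed.

Lemma star_subset S S' : @compatible_family Sy S -> @covering Sy S ->
  (star S \subset star S') = (S' \subset S).
Proof.
move=> cS covS; apply/idP/idP => [h|S'S]; last first.
  by apply/subsetP => C; rewrite !inE; apply: subset_trans.
apply: star_sub cS covS _ => C mC SC.
by have := subsetP h (to_max_clique mC); rewrite !inE; apply.
Qed.

Lemma covers_pure_iso : poset_isomorphic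
  (coherent_covers F) (fun S S' : {set route G} => S' \subset S)
  (pure_intervals F) (fun I J => I \subset J).
Proof.
exists star; last first.
  by move=> S S' [/cliqueP cS /coversP covS] _; rewrite star_subset.
split.
- by move=> S [/cliqueP cS /coversP covS]; apply: star_pure.
- move=> S S' /set_mem[/cliqueP cS /coversP covS] /set_mem[/cliqueP cS' /coversP covS'].
  move=> e; apply/eqP; rewrite eqEsubset -(star_subset _ cS' covS') e subxx /=.
  by rewrite -(star_subset _ cS covS) e subxx.
- move=> I /pure_star[S [cS covS ->]]; exists S => //.
  by split; [apply/cliqueP|apply/coversP].
Qed.

End Dictionary.

Import Order.TTheory GRing.Theory Num.Theory.
Import numFieldNormedType.Exports.

(** * Interior faces *)

Lemma cvg_ptws (R : realType) (E : finType)
    (H : set_system {ptws E -> R}) (x : {ptws E -> R}) : Filter H ->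
  (forall e, ((fun y : {ptws E -> R} => y e) @ H --> x e)%classic) ->
  (H --> x)%classic.
Proof.
move=> FH h; apply/cvg_sup => e.
have surj : ((fun y : {ptws E -> R} => y e) @` [set: {ptws E -> R}] = [set: R])%classic.
  by rewrite classical_sets.eqEsubset; split=> r // _; exists (fun=> r).
apply/cvg_image => // B nB.
exists ((fun y : {ptws E -> R} => y e) @^-1` B)%classic; first exact: h.
by rewrite image_preimage.
Qed.

Section FlowPolytope.
Local Open Scope ring_scope.
Variables (R : realType) (G : flow_graph) (F : framing G).
Implicit Types (P Q : route G) (S : {set route G}).
Implicit Types (x y z : {ptws edge G -> R}).

Let K := @flow_polytope R G.

Lemma walk_uniq u (p : seq (edge G)) v : walk u p v -> uniq p.
Proof.
elim: p u => //= e p IH u /andP[_ wp]; rewrite (IH _ wp) andbT.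
apply/negP => ep; have [_ _ /(_ e ep)[h _]] := walk_bounds wp.
by have := leq_trans (src_lt_tgt e) h; rewrite ltnn.
Qed.

Lemma walk_netflow u (p : seq (edge G)) v j : walk u p v ->
  \sum_(e <- p) ((src e == j)%:R - (tgt e == j)%:R) = (u == j)%:R - (v == j)%:R :> R.
Proof.
elim: p u => [|e p IH] u /=; first by move/eqP->; rewrite big_nil subrr.
by case/andP=> /eqP<- /IH; rewrite big_cons => ->; rewrite addrA subrK.
Qed.

Lemma indicator_in_polytope P : K (indicator R P).
Proof.
split=> [e|j]; first exact: ler0n.
have wP := route_walk P.
have sumE (A : {set edge G}) :
    \sum_(e in A) indicator R P e = \sum_(e <- P) (e \in A)%:R.
  rewrite /indicator (big_uniq _ (walk_uniq wP)) /= big_mkcond [RHS]big_mkcond.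
  by apply: eq_bigr => e _; case: (e \in A); case: (e \in _).
rewrite !sumE -sumrB; under eq_bigr => e _ do rewrite !inE.
rewrite (walk_netflow j wP) /netflow [ord0 == j]eq_sym [ord_max == j]eq_sym.
case: (eqVneq j ord0) => [->|_] /=; first by rewrite mulr0n subr0.
by case: (eqVneq j ord_max); rewrite ?mulr0n ?mulr1n ?sub0r ?subr0 ?oppr0.
Qed.

Lemma affine_netflow (A : set {ptws edge G -> R}) y : (A `<=` K)%classic -> affine_hull A y ->
  forall j, \sum_(e in Out j) y e - \sum_(e in In j) y e = netflow R j.
Proof.
move=> AK [m [t [p [Ap t1 ey]]]] j.
have -> : netflow R j = \sum_i t i * netflow R j by rewrite -mulr_suml t1 mul1r.
have sumE (B : {set edge G}) : \sum_(e in B) y e = \sum_i t i * \sum_(e in B) p i e.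
  under eq_bigr => e _ do rewrite ey.
  by rewrite exchange_big /=; apply: eq_bigr => i _; rewrite mulr_sumr.
rewrite !sumE -sumrB; apply: eq_bigr => i _.
by rewrite -mulrBr; congr (_ * _); case: (AK _ (Ap i)) => _ ->.
Qed.

Lemma convex_affine (A : set {ptws edge G -> R}) : (convex_hull A `<=` affine_hull A)%classic.
Proof. by move=> y [m [t [p [_ Ap t1 ey]]]]; exists m, t, p. Qed.

Lemma Delta_in_polytope S : (@Delta R G S `<=` K)%classic.
Proof.
move=> y Sy; have AK : ([set indicator R P | P in [set` S]] `<=` K)%classic.
  by move=> _ [P _ <-]; apply: indicator_in_polytope.
split; last exact: affine_netflow AK (convex_affine Sy).
move=> e; have [m [t [p [t0 Ap _ ->]]]] := Sy.
by apply: sumr_ge0 => i _; apply: mulr_ge0 => //; case: (AK _ (Ap i)).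
Qed.

(** The sources strictly increase along a route, so its edge set determines it. *)
Lemma route_eq_mem P Q : (P : seq _) =i (Q : seq _) -> P = Q.
Proof.
move=> h; apply: route_inj.
have srt u (p : seq (edge G)) v : walk u p v ->
    sorted (fun e f => src e < src f)%N p.
  have pth e q : walk (tgt e) q v -> path (fun e f => src e < src f)%N e q.
    elim: q e => //= f q IH e /andP[/eqP ef /IH ->].
    by rewrite ef src_lt_tgt.
  by case: p => //= e p /andP[_ /pth].
apply: (irr_sorted_eq _ _ (srt _ _ _ (route_walk P)) (srt _ _ _ (route_walk Q)) h).
  by move=> e f g; apply: ltn_trans.
by move=> e; apply: ltnn.
Qed.

(** A point of positive weight has coordinate 1 wherever the combination has
    coordinate 1, and 0 wherever it has 0. *)
Lemma indicator_Delta S P : @Delta R G S (indicator R P) <-> P \in S.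
Proof.
split=> [[m [t [p [t0 Sp t1 eP]]]]|PS]; last first.
  exists 1%N, (fun=> 1), (fun=> indicator R P); split=> //.
  - by move=> _; exists P.
  - by rewrite big_ord_recl big_ord0 addr0.
  - by move=> e; rewrite big_ord_recl big_ord0 addr0 mul1r.
have [i ti] : exists i, 0 < t i.
  apply: contrapT => h; have : \sum_i t i = 0 :> R.
    apply: big1 => i _; apply/eqP; rewrite eq_le t0 andbT leNgt.
    by apply/negP => ti; apply: h; exists i.
  by rewrite t1 => /eqP; rewrite oner_eq0.
have [Q /= QS eQ] := Sp i; suff -> : P = Q by [].
have p01 k e : p k e = 0 \/ p k e = 1.
  by have [Q' _ <-] := Sp k; rewrite /indicator; case: (_ \in _); [right|left].
apply: route_eq_mem => e; apply/idP/idP => eIn.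
  apply: contraT => eQ'; have := eP e; rewrite {1}/indicator eIn => s1.
  have : \sum_k t k * p k e < \sum_k t k.
    rewrite (bigD1 i) //= [X in _ < X](bigD1 i) //= -eQ {1}/indicator (negPf eQ').
    rewrite mulr0 ltr_leD // ler_sum // => k _.
    by case: (p01 k e) => ->; rewrite ?mulr0 ?mulr1.
  by rewrite -s1 t1 ltxx.
apply: contraT => eP'; have := eP e; rewrite {1}/indicator (negPf eP') => s0.
have : 0 < \sum_k t k * p k e.
  rewrite (bigD1 i) //= -eQ {1}/indicator eIn mulr1 ltr_pwDl // sumr_ge0 // => k _.
  by case: (p01 k e) => ->; rewrite ?mulr0 ?mulr1.
by rewrite -s0 ltxx.
Qed.

Lemma Delta_subset S S' : (@Delta R G S `<=` @Delta R G S')%classic <-> S \subset S'.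
Proof.
split=> [h|/subsetP h].
  by apply/subsetP => P /indicator_Delta/h/indicator_Delta.
move=> y [m [t [p [t0 Sp t1 ey]]]]; exists m, t, p; split=> // i.
by have [P /h PS' <-] := Sp i; exists P.
Qed.

(** The barycentre has positive coordinates, and these stay positive nearby; the
    flow equations hold on the affine hull. *)
Lemma covering_not_boundary S : covers S ->
  ~ (@Delta R G S `<=` relative_boundary K)%classic.
Proof.
move=> /forallP covS.
pose P i : route G := enum_val (i : 'I_#|S|).
have S0 : (0 < #|S|)%N.
  have [e _] := sink_unique (v := ord0 : vertex G) isT.
  by have /exists_inP[Q QS _] := covS e; apply/card_gt0P; exists Q.
have N0 : 0 < #|S|%:R :> R by rewrite ltr0n.
pose x : {ptws edge G -> R} := fun e => \sum_i #|S|%:R^-1 * indicator R (P i) e.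
have Sx : @Delta R G S x.
  exists #|S|, (fun=> #|S|%:R^-1), (fun i => indicator R (P i)); split=> //.
  - by move=> i; rewrite invr_ge0 ler0n.
  - by move=> i; exists (P i) => //=; apply: enum_valP.
  - by rewrite sumr_const card_ord -[_ *+ _]mulr_natl divff // gt_eqF.
have xpos e : 0 < x e.
  have /exists_inP[Q QS eQ] := covS e.
  rewrite /x (bigD1 (enum_rank_in QS Q)) //= /P enum_rankK_in // /indicator eQ mulr1.
  rewrite ltr_pwDl ?invr_gt0 // sumr_ge0 // => i _.
  by rewrite mulr_ge0 ?invr_ge0 ?ler0n.
move=> /(_ x Sx)[_]; apply; split; first exact: Delta_in_polytope Sx.
have near0 : \forall y \near x, forall e, 0 < y e.
  apply: (@filter_forall _ _ (fun e (y : {ptws edge G -> R}) => 0 < y e) (nbhs x) _) => e.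
  exact: (@proj_continuous (edge G) (fun=> R) e x _ (lt_nbhsr (xpos e))).
apply: (@filterS _ (nbhs x) _ _ _ _ near0) => y ypos ya; split=> [e|]; first exact: ltW.
exact: affine_netflow ya.
Qed.

(** Moving from a point x of [Delta S] slightly away from a route through the
    missing edge e stays in the affine hull and makes the coordinate e negative. *)
Lemma uncovered_boundary S : ~~ covers S ->
  (@Delta R G S `<=` relative_boundary K)%classic.
Proof.
move=> /forallPn[e nS] x Sx.
have xe : x e = 0.
  have [m [t [p [_ Sp _ ->]]]] := Sx; apply: big1 => i _.
  have [P PS <-] := Sp i; rewrite /indicator.
  suff /negPf -> : e \notin (P : seq _) by rewrite mulr0.
  by apply: contra nS => eP; apply/exists_inP; exists P.
have Kx := Delta_in_polytope Sx.
split; first exact: subset_closure.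
case=> _ near_x; have [Q eQ _] := edge_route F e.
pose y (s : R) : {ptws edge G -> R} := fun f => (1 + s) * x f - s * indicator R Q f.
have aff s : affine_hull K (y s).
  exists 2%N, (fun i => if i == ord0 then 1 + s else - s),
    (fun i => if i == ord0 then x else indicator R Q); split.
  - by move=> i; case: eqP => _ //; apply: indicator_in_polytope.
  - by rewrite !big_ord_recl big_ord0 /= addr0 addrK.
  - by move=> f; rewrite !big_ord_recl big_ord0 /= addr0 mulNr.
have cvg_y : (y s @[s --> 0^'+] --> x)%classic.
  apply: cvg_ptws => f.
  have -> : x f = (1 + 0) * x f - 0 * indicator R Q f by rewrite addr0 mul1r mul0r subr0.
  apply: cvg_at_right_filter.
  by apply: cvgB; apply: cvgMl; [apply: cvgD; [exact: cvg_cst|exact: cvg_id]|exact: cvg_id].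
have near_y := cvg_y _ near_x.
have [s [/= sK s0]] : exists s, (affine_hull K (y s) -> K (y s)) /\ 0 < s.
  apply: (@filter_ex _ (0 : R)^'+%classic).
  by apply: filterI; [exact: near_y|exact: nbhs_right_gt].
have [/(_ e) + _] := sK (aff s).
by rewrite /y xe mulr0 sub0r /indicator eQ mulr1 oppr_ge0 leNgt s0.
Qed.

Lemma faces_covers_iso : poset_isomorphic
  (interior_faces R F) (fun D D' => (D' `<=` D)%classic)
  (coherent_covers F) (fun S S' : {set route G} => S' \subset S).
Proof.
pose f (D : set {ptws edge G -> R}) := [set P | `[< D (indicator R P) >]].
have fK S : f (@Delta R G S) = S.
  by apply/setP => P; rewrite inE; apply/asboolP/idP => /indicator_Delta.
exists f; last first.
  move=> _ _ [[S _ ->] _] [[S' _ ->] _]; rewrite !fK; exact: Delta_subset.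
split.
- move=> _ [[S cS ->] nb]; rewrite /= fK; split=> //.
  by apply: contra_notT nb => /uncovered_boundary.
- by move=> _ _ /set_mem[[S _ ->] _] /set_mem[[S' _ ->] _]; rewrite !fK => ->.
- move=> S [cS covS]; exists (@Delta R G S); last exact: fK.
  by split; [exists S|apply: covering_not_boundary].
Qed.

End FlowPolytope.

Theorem theorem3p1 (R : realType) (G : flow_graph) (F : framing G) :
  poset_isomorphic
    (interior_faces R F) (fun D D' => (D' `<=` D)%classic)
    (coherent_covers F) (fun S S' => S' \subset S) /\
  poset_isomorphic
    (coherent_covers F) (fun S S' => S' \subset S)
    (pure_intervals F) (fun I J => I \subset J).
Proof. by split; [exact: faces_covers_iso|exact: covers_pure_iso]. Qed.
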